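(* Let $\mathcal{A}$ be a finite set and let $\{\varphi_i(x)=rx+t_i\}_{i\in\mathcal{A}}$ be an equicontractive iterated function system on $\mathbb{R}$ (with common ratio $r\in(-1,0)\cup(0,1)$) satisfying the convex strong separation condition and whose self-similar set $X$ is contained in $[1,\infty)$. Let $(p_i)_{i\in\mathcal{A}}$ be a probability vector satisfying $$\frac12<\frac{-\sum_{i\in\mathcal{A}}p_i\log p_i}{-\log|r|}.$$ Let $\mu$ be the self-similar measure corresponding to $\{\varphi_i\}_{i\in\mathcal{A}}$ and $(p_i)_{i\in\mathcal{A}}$. Then for $\mu$-almost every $x$ the sequence $(x^n)_{n=1}^{\infty}$ is uniformly distributed modulo one.
   Context: An iterated function system (IFS) is a finite set $\{\varphi_i\}_{i\in\mathcal{A}}$ of maps $\varphi_i:\mathbb{R}\to\mathbb{R}$, $\varphi_i(x)=r_ix+t_i$ with $r_i\in(-1,0)\cup(0,1)$ and $t_i\in\mathbb{R}$. It is equicontractive if all $r_i$ are equal to a common value $r$. Its self-similar set is the unique non-empty compact set $X\subset\mathbb{R}$ with $X=\bigcup_{i\in\mathcal{A}}\varphi_i(X)$. The IFS satisfies the convex strong separation condition if $\varphi_i(\mathrm{conv}(X))\cap\varphi_j(\mathrm{conv}(X))=\emptyset$ for all $i\neq j$, where $\mathrm{conv}(X)$ is the convex hull of $X$. For a probability vector $\mathbf{p}=(p_i)_{i\in\mathcal{A}}$ ($p_i\ge 0$, $\sum_i p_i=1$), the corresponding self-similar measure is the unique Borel probability measure $\mu$ on $\mathbb{R}$ with $\mu=\sum_{i\in\mathcal{A}}p_i\cdot\mu\circ\varphi_i^{-1}$.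 The convention $0\log 0=0$ is used. A real sequence $(x_n)_{n=1}^\infty$ is uniformly distributed modulo one if for all $0\le u<v\le 1$, $\lim_{N\to\infty}\frac1N\#\{1\le n\le N: x_n \bmod 1\in[u,v]\}=v-u$. *)

(* Defs.v *)
From HB Require Import structures.
From mathcomp Require Import all_boot all_order all_algebra.
From mathcomp Require Import all_classical all_reals all_analysis.
Set Implicit Arguments.
Unset Strict Implicit.
Unset Printing Implicit Defensive.
Import Order.TTheory GRing.Theory Num.Theory.
Import numFieldNormedType.Exports.
Local Open Scope classical_set_scope.
Local Open Scope ring_scope.

Definition similarity (R : realType) (r t x : R) : R := r * x + t.

Definition convex_hull (R : realType) (X : set R) : set R :=
  smallest (@convex_set R R^o) X.

Definition self_similar_set (R : realType) (A : finType)
    (phi : A -> R -> R) (X : set R) : Prop :=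
  [/\ X !=set0, compact X & X = \bigcup_(i in [set: A]) (phi i @` X)].

Definition convex_strong_separation (R : realType) (A : finType)
    (phi : A -> R -> R) (X : set R) : Prop :=
  forall i j : A, i != j ->
    (phi i @` convex_hull X) `&` (phi j @` convex_hull X) = set0.

Definition probability_vector (R : realType) (A : finType) (p : A -> R) : Prop :=
  (forall i, 0 <= p i) /\ \sum_(i : A) p i = 1.

(* [ln0] gives [ln 0 = 0], so the convention 0 log 0 = 0 holds. *)
Definition entropy (R : realType) (A : finType) (p : A -> R) : R :=
  - \sum_(i : A) p i * ln (p i).

(* [measurableTypeR R] is R with its Borel sigma-algebra. *)
Definition self_similar_measure (R : realType) (A : finType)
    (phi : A -> R -> R) (p : A -> R)
    (mu : probability (measurableTypeR R) R) : Prop :=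
  forall B : set (measurableTypeR R), measurable B ->
    mu B = (\sum_(i : A)
      (p i)%:E * pushforward mu (phi i : measurableTypeR R -> measurableTypeR R) B)%E.

Definition mod1 (R : realType) (x : R) : R := x - (Num.floor x)%:~R.

(* Sequences are indexed from 1: the value [x 0] is never used. *)
Definition uniformly_distributed_mod1 (R : realType) (x : nat -> R) : Prop :=
  forall u v : R, 0 <= u -> u < v -> v <= 1 ->
    (fun N : nat =>
       (\sum_(1 <= n < N.+1 | (u <= mod1 (x n) <= v)%R) 1)%N%:R / N%:R : R)
      @ \oo --> v - u.

(* Main.v *)
Require Import Defs.
From mathcomp Require Import all_boot all_order all_algebra.
From mathcomp Require Import all_classical all_reals all_analysis.
From mathcomp Require Import measurable_realfun.
From mathcomp Require Import ring lra zify.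
Set Implicit Arguments.
Unset Strict Implicit.
Unset Printing Implicit Defensive.
Import Order.TTheory GRing.Theory Num.Theory.
Import numFieldNormedType.Exports.
Local Open Scope classical_set_scope.
Local Open Scope ring_scope.

(** Weyl's criterion reduces the theorem to exponential sums: almost surely, for
    every integer [l > 0], the sum over [n <= N] of [e (l x ^ n)] is [o (N)].  Its
    squared modulus integrates to a double sum, over [n] and [j], of the integrals of
    [cos (2 pi l (x ^ n - x ^ j))].  If those with [j < n] are [O (1 / n)], the
    second moment is [O (N)]; the Borel-Cantelli lemma along [N = k ^ 2] then gives
    the claim, because the sums cannot change much between consecutive squares
    ([ae_weyl_sums]).

    The decay of these oscillatory integrals ([power_phase_decay]) is the heart of
    the matter.  Self-similar measures need not have Fourier decay, but the phase
    [F = 2 pi l (x ^ n - x ^ j)] is strongly convex, and this is what is used.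
    Restrict to a small cylinder on which [1 < a <= x <= b] with [b / a] close to 1,
    so that the second derivative of [F] lies between [a ^ n] and [b ^ n] up to
    polynomial factors.  Choose the level [m] so that [b ^ n * |r| ^ (2 m)] is
    slightly less than 1, and split a long word into two blocks [u], [v] of length [m]
    and a remainder.  A Taylor expansion gives, up to a negligible error,

      [F (phi_u (phi_v al)) = F (phi_u al) + r ^ m * F' (phi_u al) * (phi_v al - al)],

    that is, a phase which is bilinear in a frequency depending on [u] and a position
    depending on [v] ([phase_mean_linearize]).  The positions are separated by the
    separation of cylinders, the frequencies by the same separation together with the
    convexity of [F].  After both are rounded to grids, the sum is a bilinear form in
    the matrix of the discrete Fourier transform of an order [M] comparable to
    [|r| ^ (- m)], up to a factor whose exponential rate is small when [b / a] is close
    to 1; by Parseval its norm is [sqrt M] ([bilinear_sum_Zmod], [bilinear_sum_separated]).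
    Chebyshev's inequality allows one to discard the words whose probability exceeds
    [exp (- m (h - eta))], where [h] is the entropy of [p].  What remains is at most
    [sqrt M * exp (- m (h - eta))] ([phase_mean_level]), which decays
    exponentially for small [eta] because [h > - ln |r| / 2]: this is the hypothesis on
    the dimension.

    No integral is taken.  Cosines of Lipschitz phases are averaged over the
    words of a high level, with weights the products of the [p i], and the passage to
    [mu] is Markov's inequality on cylinders ([pr_markov]). *)

(** * Trigonometric sums and the discrete Fourier transform *)

Section TrigSums.
Context {R : realType}.
Implicit Types (x y c t : R) (z : int).

Lemma cosD2piz x z : cos (x + z%:~R * (pi *+ 2)) = cos x.
Proof.
case: z => n.
  rewrite -[(Posz n)%:~R]/(n%:R) mulr_natl.
  exact: (periodicn (@cosD2pi R) n x).
rewrite NegzE mulrNz mulNr -[_%:~R]/(n.+1%:R) mulr_natl.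
rewrite -[RHS](@congr1 _ _ cos _ _ (subrK ((pi *+ 2) *+ n.+1) x)).
by rewrite (periodicn (@cosD2pi R)).
Qed.

Lemma sinD2piz x z : sin (x + z%:~R * (pi *+ 2)) = sin x.
Proof. by rewrite -cosBpihalf addrAC cosD2piz cosBpihalf. Qed.

Lemma dist_cos x y : `|cos x - cos y| <= `|x - y|.
Proof.
wlog xy : x y / x <= y.
  move=> W; have [/W//|/ltW/W] := leP x y.
  by rewrite distrC [leRHS]distrC.
rewrite distrC [leRHS]distrC.
have [a _ ->] := @MVT_segment R cos (fun t => - sin t) x y xy
  (fun t _ => is_derive_cos t) (continuous_subspaceT (@continuous_cos R)).
by rewrite normrM normrN ler_piMl// sin_max.
Qed.

(** Multiplying by [2 sin (t / 2)] makes the sum telescope. *)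
Lemma dirichlet_sum c t n :
  2 * sin (t / 2) * (\sum_(k < n) cos (c + k%:R * t)) =
  sin (c - t / 2 + n%:R * t) - sin (c - t / 2).
Proof.
elim: n => [|n IH]; first by rewrite big_ord0 mulr0 mul0r addr0 subrr.
rewrite big_ord_recr/= mulrDr IH.
have -> : c - t / 2 + n.+1%:R * t = (c + n%:R * t) + t / 2.
  by rewrite -(natr1 n); field.
have -> : c - t / 2 + n%:R * t = (c + n%:R * t) - t / 2 by field.
set y := c + n%:R * t; rewrite (sinB y) (sinD y); ring.
Qed.

Lemma dirichlet_bound c t n : sin (t / 2) != 0 ->
  `|\sum_(k < n) cos (c + k%:R * t)| <= `|sin (t / 2)|^-1.
Proof.
move=> s0; have s1 : 0 < `|sin (t / 2)| by rewrite normr_gt0.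
rewrite -[leRHS]mul1r ler_pdivlMr//.
have := congr1 Num.norm (dirichlet_sum c t n); rewrite !normrM normr_nat => E.
have := ler_normB (sin (c - t / 2 + n%:R * t)) (sin (c - t / 2)).
have := sin_max (c - t / 2 + n%:R * t); have := sin_max (c - t / 2).
by move: E; set S := `|\sum_(_ < _) _|; lra.
Qed.

(** The characters of Z/M are orthogonal: the telescoped sum runs over a whole number
    of periods, and [sin (t / 2)] does not vanish because [M] does not divide [z]. *)
Lemma sum_cos_root c z (M : nat) : (0 < `|z| < M)%N ->
  \sum_(k < M) cos (c + k%:R * (z%:~R * (pi *+ 2) / M%:R)) = 0.
Proof.
move=> /andP[z0 zM].
have M0 : 0 < M%:R :> R by rewrite ltr0n (leq_trans _ zM).
have s_gt0 n : (0 < n < M)%N -> 0 < sin (n%:R * (pi *+ 2) / M%:R / 2 : R).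
  move=> /andP[n0 nM]; rewrite (_ : _ / 2 = n%:R * pi / M%:R); last first.
    by field; rewrite gt_eqF.
  rewrite sin_gt0_pi// !divr_gt0 ?mulr_gt0 ?ltr0n ?pi_gt0 ?(ltn_trans n0 nM)//=.
  by rewrite ltr_pdivrMr ?ltr0n ?(ltn_trans n0)// mulrC ltr_pM2l ?pi_gt0// ltr_nat.
have s0 : sin (z%:~R * (pi *+ 2) / M%:R / 2 : R) != 0.
  case: z z0 zM => k z0 zM; first by rewrite gt_eqF// s_gt0// z0.
  by rewrite NegzE mulrNz !mulNr sinN oppr_eq0 gt_eqF// s_gt0.
set t := _ / M%:R in s0 *.
have Mt : M%:R * t = z%:~R * (pi *+ 2) by rewrite /t mulrCA divff ?mulr1 ?gt_eqF.
apply: (mulfI (_ : 2 * sin (t / 2) != 0)); first by rewrite mulf_neq0// pnatr_eq0.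
by rewrite dirichlet_sum Mt sinD2piz subrr mulr0.
Qed.

Lemma cauchy_schwarz_sum (I : finType) (u v : I -> R) :
  (\sum_i u i * v i) ^+ 2 <= (\sum_i u i ^+ 2) * (\sum_i v i ^+ 2).
Proof.
rewrite -subr_ge0.
have -> : (\sum_i u i ^+ 2) * (\sum_i v i ^+ 2) - (\sum_i u i * v i) ^+ 2 =
   2^-1 * \sum_i \sum_j (u i * v j - u j * v i) ^+ 2.
  have E (f g : I -> R) : (\sum_i f i) * (\sum_i g i) = \sum_i \sum_j f i * g j.
    by rewrite mulr_suml; apply: eq_bigr => i _; rewrite mulr_sumr.
  rewrite expr2 !E.
  set S1 := (X in X - _); set S2 := (X in _ - X).
  have -> : \sum_i \sum_j (u i * v j - u j * v i) ^+ 2 = S1 + S1 - S2 *+ 2.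
    have S1E : S1 = \sum_i \sum_j u j ^+ 2 * v i ^+ 2 by rewrite /S1 exchange_big.
    rewrite {2}S1E /S1 /S2 -big_split/= -sumrMnl -sumrB.
    apply: eq_bigr => i _; rewrite -big_split/= -sumrMnl -sumrB.
    by apply: eq_bigr => j _; ring.
  by field.
by rewrite mulr_ge0//; apply: sumr_ge0 => i _; apply: sumr_ge0 => j _; rewrite sqr_ge0.
Qed.

(** The square of a sum of cosines plus the square of the sum of sines is the
    squared modulus of an exponential sum; expanding it leaves differences of
    phases only. *)
Lemma sqr_sum_cos_sin (I : finType) (u c : I -> R) :
  (\sum_i u i * cos (c i)) ^+ 2 + (\sum_i u i * sin (c i)) ^+ 2 =
  \sum_i \sum_j u i * u j * cos (c i - c j).
Proof.
have E (f g : I -> R) : (\sum_i f i) * (\sum_i g i) = \sum_i \sum_j f i * g j.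
  by rewrite mulr_suml; apply: eq_bigr => i _; rewrite mulr_sumr.
rewrite !expr2 !E -big_split/=; apply: eq_bigr => i _.
rewrite -big_split/=; apply: eq_bigr => j _.
by rewrite cosB; ring.
Qed.

(** Adding the square of the corresponding sum of sines, which is nonnegative, makes
    all off-diagonal terms vanish by orthogonality. *)
Lemma parseval_Zmod (I : finType) (u c : I -> R) (z : I -> int) (M : nat) :
  (forall i j, i != j -> (0 < `|z i - z j| < M)%N) ->
  \sum_(k < M) (\sum_i u i * cos (c i + k%:R * ((z i)%:~R * (pi *+ 2) / M%:R))) ^+ 2
  <= M%:R * \sum_i u i ^+ 2.
Proof.
move=> hz.
pose th i : R := (z i)%:~R * (pi *+ 2) / M%:R.
apply: (@le_trans _ _ (\sum_(k < M) \sum_i \sum_j u i * u j *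
    cos ((c i + k%:R * th i) - (c j + k%:R * th j)))).
  apply: ler_sum => k _.
  rewrite -(@sqr_sum_cos_sin _ u (fun i => c i + k%:R * th i)).
  by rewrite lerDl sqr_ge0.
rewrite exchange_big/= mulr_sumr; apply: ler_sum => i _.
rewrite exchange_big/= (bigD1 i)//= [X in _ + X]big1 ?addr0.
  rewrite (eq_bigr (fun=> u i * u i)); last by move=> k _; rewrite subrr cos0 mulr1.
  by rewrite sumr_const card_ord mulr_natl expr2.
move=> j ji; rewrite -mulr_sumr.
under eq_bigr => k _.
  rewrite (_ : _ - _ = (c i - c j) + k%:R * ((z i - z j)%:~R * (pi *+ 2) / M%:R)).
    over.
  by rewrite /th intrB; ring.
by rewrite sum_cos_root ?mulr0// hz// eq_sym.
Qed.

(** By Cauchy-Schwarz in [j] and Parseval in [k]: the matrix of the discrete Fourier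
    transform of order [M] has operator norm [sqrt M]. *)
Lemma bilinear_sum_Zmod (I : finType) (u v c : I -> R) (z : I -> int) (M : nat)
    (k : I -> 'I_M) : injective k ->
  (forall i j, i != j -> (0 < `|z i - z j| < M)%N) ->
  (\sum_i \sum_j u i * v j *
     cos (c i + (k j)%:R * ((z i)%:~R * (pi *+ 2) / M%:R))) ^+ 2
  <= M%:R * (\sum_i u i ^+ 2) * (\sum_i v i ^+ 2).
Proof.
move=> kinj hz.
pose H (n : 'I_M) := \sum_i u i * cos (c i + n%:R * ((z i)%:~R * (pi *+ 2) / M%:R)).
rewrite exchange_big/=.
under eq_bigr => j _.
  rewrite (_ : (\sum_i _) = v j * H (k j)); first over.
  by rewrite /H mulr_sumr; apply: eq_bigr => i _; ring.
apply: le_trans (cauchy_schwarz_sum _ _) _.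
rewrite mulrC ler_wpM2r ?sumr_ge0// => [i _|]; first by rewrite sqr_ge0.
apply: le_trans (parseval_Zmod u c hz).
rewrite -(big_imset (fun n => H n ^+ 2))/=; last by move=> ? ? _ _ /kinj.
rewrite [leRHS](bigID (mem [set k x | x in I]%SET))/= lerDl.
by apply: sumr_ge0 => n _; rewrite sqr_ge0.
Qed.

End TrigSums.

(** * Weyl's criterion *)

Section Weyl.
Context {R : realType}.
Implicit Types (x : nat -> R) (t y s u v d : R) (z : int) (K N c : nat).

Definition cesaro (g : nat -> R) N : R := (\sum_(1 <= n < N.+1) g n) / N%:R.

Definition weyl_sums_vanish x : Prop := forall l : nat, (0 < l)%N ->
  cesaro (fun n => cos (l%:R * (pi *+ 2 * x n))) @ \oo --> (0 : R) /\
  cesaro (fun n => sin (l%:R * (pi *+ 2 * x n))) @ \oo --> (0 : R).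

(** The squared modulus of the sum of [e (k t / 2 pi)] over [k < K]. *)
Definition fejer K t : R := \sum_(k < K) \sum_(k' < K) cos (k%:R * t - k'%:R * t).

Lemma fejerE K t : fejer K t =
  (\sum_(k < K) cos (0 + k%:R * t)) ^+ 2 + (\sum_(k < K) cos (- (pi / 2) + k%:R * t)) ^+ 2.
Proof.
have := sqr_sum_cos_sin (fun=> 1) (fun k : 'I_K => k%:R * t).
under eq_bigr do rewrite mul1r.
under [X in _ + X ^+ 2]eq_bigr do rewrite mul1r.
under [RHS]eq_bigr => k _ do under eq_bigr do rewrite !mul1r.
rewrite /fejer => <-; congr (_ ^+ 2 + _ ^+ 2); apply: eq_bigr => k _; first by rewrite add0r.
by rewrite addrC cosBpihalf.
Qed.

Lemma fejer_ge0 K t : 0 <= fejer K t.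
Proof. by rewrite fejerE addr_ge0// sqr_ge0. Qed.

Lemma fejer_le K t d : 0 < d -> d <= `|sin (t / 2)| -> fejer K t <= 2 / d ^+ 2.
Proof.
move=> d0 dt; have s0 : sin (t / 2) != 0 by rewrite -normr_gt0 (lt_le_trans d0).
have B (a : R) : (\sum_(k < K) cos (a + k%:R * t)) ^+ 2 <= (d ^+ 2)^-1.
  rewrite -exprVn -[leLHS]real_normK ?num_real// lerXn2r ?nnegrE ?invr_ge0 ?(ltW d0)//.
  by rewrite (le_trans (dirichlet_bound _ _ s0))// lef_pV2// posrE normr_gt0.
by rewrite fejerE mulr_natl mulr2n lerD.
Qed.

(** Only the diagonal terms [k = k'] survive the average over the [K]-th roots of
    unity. *)
Lemma fejer_grid K t : (0 < K)%N ->
  \sum_(i < K) fejer K (t - i%:R * (pi *+ 2) / K%:R) = K%:R ^+ 2.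
Proof.
move=> K0; rewrite exchange_big/=.
rewrite (eq_bigr (fun=> K%:R)); last first.
  move=> k _; rewrite exchange_big/= (bigD1 k)//= [X in _ + X]big1 ?addr0.
    rewrite (eq_bigr (fun=> 1)); last by move=> i _; rewrite subrr cos0.
    by rewrite sumr_const card_ord.
  move=> k' kk'.
  rewrite -[RHS](@sum_cos_root R ((k%:R - k'%:R) * t) (k'%:Z - k%:Z) K); last first.
    move: (ltn_ord k) (ltn_ord k') kk'; rewrite -val_eqE/=; lia.
  by apply: eq_bigr => i _; congr cos; rewrite intrB/= -!pmulrn; ring.
by rewrite sumr_const card_ord expr2 mulr_natr.
Qed.

(** A trigonometric polynomial that is nearly 1 on the arc [s, s + c / K] away
    from its endpoints, and has mean [c / K]. *)
Definition arc_kernel K s c y : R :=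
  (K%:R ^+ 2)^-1 * \sum_(i < c) fejer K (pi *+ 2 * (y - s) - i%:R * (pi *+ 2) / K%:R).

Lemma arc_kernel_ge0 K s c y : 0 <= arc_kernel K s c y.
Proof. by rewrite mulr_ge0 ?invr_ge0 ?sqr_ge0// sumr_ge0// => i _; rewrite fejer_ge0. Qed.

(** The symmetries [y -> - y] and [y -> 1 - y] reduce this to [[0, 1 / 2]], where
    [sin (pi y)] increases. *)
Lemma sin_pi_ge d y : 0 < d -> d <= 1 / 2 -> d <= `|y| -> `|y| <= 1 - d ->
  sin (pi * d) <= `|sin (pi * y)|.
Proof.
move=> d0 d1; wlog y0 : y / 0 <= y.
  move=> W; have [/W//|/ltW y0] := leP 0 y.
  by rewrite -(normrN y) -(normrN (sin _)) -sinN -mulrN; apply: W; rewrite oppr_ge0.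
rewrite ger0_norm// => dy yd; have p0 := @pi_gt0 R.
rewrite ger0_norm; last by rewrite sin_ge0_pi//; apply/andP; split; nra.
wlog yh : y y0 dy yd / y <= 1 / 2.
  move=> W; have [/W->//|yh] := leP y (1 / 2).
  have -> : pi * y = - (pi * (1 - y)) + pi by ring.
  by rewrite sinDpi sinN opprK; apply: W; lra.
have [->//|dy'] := eqVneq d y.
apply/ltW; rewrite ltr_sin ?in_itv/=; first by rewrite ltr_pM2l// lt_neqAle dy'.
  by apply/andP; split; nra.
by apply/andP; split; nra.
Qed.

(** The translates of the Fejer kernel along the full grid sum to 1, and those omitted
    are centred at a distance at least [d] from [y] modulo 1, where the kernel is
    small. *)
Lemma arc_kernel_near1 K s c d y : (0 < K)%N -> (c <= K)%N -> 0 < d -> d <= 1 / 2 ->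
  s + d <= y -> y <= s + c%:R / K%:R - d ->
  1 - 2 / (sin (pi * d) ^+ 2 * K%:R) <= arc_kernel K s c y.
Proof.
move=> K0 cK d0 d1 sy yc.
have KR : 0 < K%:R :> R by rewrite ltr0n.
have sd0 : 0 < sin (pi * d).
  by rewrite sin_gt0_pi// mulr_gt0 ?pi_gt0//= gtr_pMr ?pi_gt0//; lra.
have E : 1 = arc_kernel K s K y.
  by rewrite /arc_kernel fejer_grid// mulVf// expf_neq0// gt_eqF.
have E2 : arc_kernel K s K y = arc_kernel K s c y +
   (K%:R ^+ 2)^-1 * \sum_(c <= i < K) fejer K (pi *+ 2 * (y - s) - i%:R * (pi *+ 2) / K%:R).
  rewrite /arc_kernel -mulrDr; congr (_ * _).
  by rewrite -(big_mkord xpredT (fun i => fejer K (_ - i%:R * _ / _)))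
    -(big_mkord xpredT (fun i => fejer K (_ - i%:R * _ / _))) -big_cat_nat.
rewrite {1}E E2 -addrA gerDl subr_le0.
apply: (@le_trans _ _ ((K%:R ^+ 2)^-1 * \sum_(c <= i < K) (2 / sin (pi * d) ^+ 2))).
  rewrite ler_wpM2l ?invr_ge0 ?sqr_ge0//.
  apply: ler_sum_nat => i /andP[ci iK]; apply: fejer_le => //.
  have -> : (pi *+ 2 * (y - s) - i%:R * (pi *+ 2) / K%:R) / 2 = pi * (y - s - i%:R / K%:R).
    by field; rewrite gt_eqF.
  have ciR : c%:R / K%:R <= i%:R / K%:R :> R by rewrite ler_pM2r ?invr_gt0// ler_nat.
  have iKR : i%:R / K%:R <= 1 :> R by rewrite ler_pdivrMr// mul1r ler_nat ltnW.
  by apply: sin_pi_ge => //; rewrite ler0_norm; lra.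
rewrite sumr_const_nat -[X in _ * X <= _]mulr_natl.
have : (K - c)%:R <= K%:R :> R by rewrite ler_nat leq_subr.
set q := (K - c)%:R => qK.
have -> : 2 / (sin (pi * d) ^+ 2 * K%:R) = (K%:R ^+ 2)^-1 * (K%:R * (2 / sin (pi * d) ^+ 2)).
  by field; rewrite !gt_eqF.
by rewrite ler_pM2l ?invr_gt0 ?exprn_gt0// ler_pM2r ?divr_gt0 ?exprn_gt0.
Qed.

Lemma cesaro_cos_cvg0 x z (a : R) :
  weyl_sums_vanish x ->
  z != 0 -> cesaro (fun n => cos (a + z%:~R * (pi *+ 2 * x n))) @ \oo --> (0 : R).
Proof.
move=> hx.
have pos l (b : R) : (0 < l)%N ->
    cesaro (fun n => cos (b + l%:R * (pi *+ 2 * x n))) @ \oo --> (0 : R).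
  move=> l0.
  have -> : cesaro (fun n => cos (b + l%:R * (pi *+ 2 * x n))) =
     (fun N => cos b * cesaro (fun n => cos (l%:R * (pi *+ 2 * x n))) N +
               - sin b * cesaro (fun n => sin (l%:R * (pi *+ 2 * x n))) N).
    apply/funext => N; rewrite /cesaro !mulrA -mulrDl; congr (_ / _).
    rewrite !mulr_sumr -big_split/=; apply: eq_bigr => n _.
    by rewrite cosD; ring.
  rewrite -[X in _ --> X](_ : cos b * 0 + - sin b * 0 = 0); last by rewrite !mulr0 addr0.
  by apply: cvgD; apply: cvgMl_tmp; have [] := hx l l0.
case: z => l l0; first by apply: pos; case: l l0.
rewrite NegzE; have := @pos l.+1 (- a) isT.
rewrite (_ : (fun n => cos (- a + _)) = (fun n => cos (a + (- l.+1%:Z)%:~R * (pi *+ 2 * x n))))//.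
apply/funext => n; rewrite -cosN; congr cos.
by rewrite mulrNz -pmulrn; ring.
Qed.

(** The kernel is a trigonometric polynomial, so only its constant term contributes in
    the limit. *)
Lemma cesaro_arc_kernel_cvg x K s c :
  weyl_sums_vanish x ->
  (0 < K)%N ->
  cesaro (fun n => arc_kernel K s c (x n)) @ \oo --> (c%:R / K%:R : R).
Proof.
move=> hx K0.
have KR : K%:R != 0 :> R by rewrite pnatr_eq0 -lt0n.
pose f (i : 'I_c) (k k' : 'I_K) : R -> R := fun y =>
  cos (- ((k%:Z - k'%:Z)%:~R * (pi *+ 2 * s + i%:R * (pi *+ 2) / K%:R)) +
     (k%:Z - k'%:Z)%:~R * (pi *+ 2 * y)).
have -> : cesaro (fun n => arc_kernel K s c (x n)) = (fun N => (K%:R ^+ 2)^-1 *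
    \sum_(i < c) \sum_(k < K) \sum_(k' < K) cesaro (fun n => f i k k' (x n)) N).
  apply/funext => N; rewrite /cesaro.
  under [in RHS]eq_bigr do under eq_bigr do rewrite -mulr_suml exchange_big/=.
  under [in RHS]eq_bigr do rewrite -mulr_suml exchange_big/=.
  rewrite -mulr_suml exchange_big/= mulrA; congr (_ / _).
  rewrite mulr_sumr; apply: eq_bigr => n _; congr (_ * _).
  apply: eq_bigr => i _; apply: eq_bigr => k _; apply: eq_bigr => k' _.
  by rewrite /f; congr cos; rewrite intrB -!pmulrn; ring.
have -> : c%:R / K%:R = (K%:R ^+ 2)^-1 *
   \sum_(i < c) \sum_(k < K) \sum_(k' < K) (k == k')%:R :> R.
  rewrite (eq_bigr (fun=> K%:R)); last first.
    move=> i _; rewrite (eq_bigr (fun=> 1)) ?sumr_const ?card_ord// => k _.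
    rewrite (bigD1 k)//= eqxx [X in _ + X]big1 ?addr0// => k' /negbTE.
    by rewrite eq_sym => ->.
  by rewrite sumr_const card_ord -[X in _ = _ * X]mulr_natl; field.
apply: cvgMl_tmp.
apply: cvg_big => [|i _]; first exact: add_continuous.
apply: cvg_big => [|k _]; first exact: add_continuous.
apply: cvg_big => [|k' _]; first exact: add_continuous.
have [<-|kk'] := eqVneq k k'.
  apply/cvgrPdist_le => e e0; exists 1%N => //= N N1.
  rewrite /cesaro (eq_bigr (fun=> 1)); last first.
    by move=> n _; rewrite /f subrr !mul0r oppr0 addr0 cos0.
  rewrite sumr_const_nat subSS subn0 divff ?subrr ?normr0 ?(ltW e0)//.
  by rewrite pnatr_eq0 -lt0n.
apply: cesaro_cos_cvg0 => //.
by rewrite subr_eq0; apply: contra kk' => /eqP[]/val_inj->.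
Qed.

Definition in_arc x u v n : R := (u <= x n <= v)%R%:R.

Lemma in_arc_freqE x u v N :
  (\sum_(1 <= n < N.+1 | (u <= x n <= v)%R) 1)%N%:R / N%:R = cesaro (in_arc x u v) N.
Proof.
rewrite /cesaro /in_arc natr_sum big_mkcond/=; congr (_ / _).
by apply: eq_bigr => n _; case: ifP.
Qed.

Lemma ler_cesaro (f g : nat -> R) N : (forall n, f n <= g n) -> cesaro f N <= cesaro g N.
Proof.
by move=> fg; rewrite /cesaro ler_wpM2r ?invr_ge0// ler_sum.
Qed.

Lemma cesaroD (f g : nat -> R) N : cesaro (fun n => f n + g n) N = cesaro f N + cesaro g N.
Proof. by rewrite /cesaro big_split/= mulrDl. Qed.

Lemma cesaro_cst (a : R) N : (0 < N)%N -> cesaro (fun=> a) N = a.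
Proof.
move=> N0; rewrite /cesaro sumr_const_nat subSS subn0 -[X in X / _]mulr_natr mulfK//.
by rewrite pnatr_eq0 -lt0n.
Qed.

(** The indicator function of the arc is majorized, up to a small constant, by the
    kernel of a slightly longer arc. *)
Lemma weyl_upper x u v (e : R) :
  weyl_sums_vanish x ->
  u <= v -> 0 < e ->
  \forall N \near \oo, cesaro (in_arc x u v) N <= v - u + e.
Proof.
move=> hx uv e0.
pose d := Num.min (e / 8) (1 / 4).
have d0 : 0 < d by rewrite lt_min; apply/andP; split; lra.
have d1 : d <= 1 / 4 by rewrite ge_min lexx orbT.
have de : d <= e / 8 by rewrite ge_min lexx.
have p0 := @pi_gt0 R.
have s0 : 0 < sin (pi * d) by rewrite sin_gt0_pi//; apply/andP; split; nra.
(* The loss is [2 d] for the longer arc, [1 / K] for rounding its length to the grid,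
   and [2 / (sin (pi d) ^ 2 K)] for the kernel. *)
pose B := 8 / e + 16 / (sin (pi * d) ^+ 2 * e).
have B1 : 0 < 8 / e by rewrite divr_gt0.
have B2 : 0 < 16 / (sin (pi * d) ^+ 2 * e) by rewrite divr_gt0// mulr_gt0// exprn_gt0.
pose K := Num.bound B.
have KB : B < K%:R by apply: archi_boundP; apply: ltW; rewrite addr_gt0.
have KR : 0 < K%:R :> R by apply: lt_trans KB; rewrite addr_gt0.
have K0 : (0 < K)%N by rewrite ltr0n in KR.
have K1 : K%:R^-1 <= e / 8.
  have -> : e / 8 = (8 / e)^-1 by rewrite invf_div.
  by rewrite lef_pV2 ?posrE// ltW// (lt_trans _ KB)// ltrDl.
have K2 : 2 / (sin (pi * d) ^+ 2 * K%:R) <= e / 8.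
  rewrite ler_pdivrMr ?mulr_gt0 ?exprn_gt0//.
  have : 16 / (sin (pi * d) ^+ 2 * e) <= K%:R by rewrite ltW// (lt_trans _ KB)// ltrDr.
  by rewrite ler_pdivrMr ?mulr_gt0 ?exprn_gt0//; nra.
have w0 : 0 <= K%:R * (v - u + 2 * d) by rewrite mulr_ge0 ?ltW//; lra.
pose c := (Num.truncn (K%:R * (v - u + 2 * d))).+1.
have /andP[c1 c2] := truncn_itv w0; rewrite -/c in c2.
have cK : c%:R / K%:R <= v - u + 2 * d + K%:R^-1.
  by rewrite ler_pdivrMr// mulrDl mulVf ?gt_eqF// /c -natr1 lerD2r [leRHS]mulrC.
have Kc : v - u + 2 * d <= c%:R / K%:R by rewrite ler_pdivlMr// mulrC ltW.
(* If [c > K] the longer arc is the whole circle and the bound is at least 1. *)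
have [cleK|Kltc] := leqP c K; last first.
  exists 1%N => //= N N1.
  have : 1 <= v - u + 2 * d.
    rewrite -(@ler_pM2l _ K%:R)// mulr1; apply: le_trans c1.
    by rewrite ler_nat -ltnS.
  suff : cesaro (in_arc x u v) N <= 1 by lra.
  rewrite -[leRHS](@cesaro_cst _ N)//; apply: ler_cesaro => n.
  by rewrite /in_arc lern1 leq_b1.
pose h := arc_kernel K (u - d) c.
have hn n : in_arc x u v n <= h (x n) + e / 8.
  rewrite /in_arc; case: (boolP (_ <= _ <= _)) => [/andP[ux xv]|_]; last first.
    by rewrite addr_ge0 ?arc_kernel_ge0//; lra.
  have := @arc_kernel_near1 K (u - d) c d (x n) K0 cleK d0.
  by rewrite -/h => /(_ ltac:(lra) ltac:(lra) ltac:(lra)); rewrite /=; lra.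
have /cvgrPdist_le/(_ (e / 8)) := @cesaro_arc_kernel_cvg x K (u - d) c hx K0.
move=> /(_ ltac:(lra)) [N0 _ HN0].
exists N0.+1 => //= N NN.
apply: (@le_trans _ _ (cesaro (fun n => h (x n)) N + e / 8)).
  rewrite -[X in _ + X](@cesaro_cst _ N) -?cesaroD; first exact: ler_cesaro.
  exact: leq_ltn_trans NN.
have := HN0 N (ltnW NN); rewrite -/h distrC ler_norml => /andP[_].
lra.
Qed.

(** An upper bound for all arcs gives a lower bound as well: it is applied to the arc
    and to the two arcs [[0, u]] and [[v, 1]] that complement it. *)
Lemma weyl_criterion x :
  weyl_sums_vanish x ->
  uniformly_distributed_mod1 x.
Proof.
move=> hx u v u0 uv v1.
pose y n := mod1 (x n).
have yE n (l : nat) : l%:R * (pi *+ 2 * x n) =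
    l%:R * (pi *+ 2 * y n) + (l%:Z * Num.floor (x n))%:~R * (pi *+ 2).
  by rewrite /y /mod1 intrM -pmulrn; ring.
have hy : weyl_sums_vanish y.
  move=> l /hx[hc hs]; split.
    rewrite (_ : (fun n => cos _) = (fun n => cos (l%:R * (pi *+ 2 * x n))))//.
    by apply/funext => n; rewrite yE cosD2piz.
  rewrite (_ : (fun n => sin _) = (fun n => sin (l%:R * (pi *+ 2 * x n))))//.
  by apply/funext => n; rewrite yE sinD2piz.
apply/cvgrPdist_le => e e0.
have e2 : 0 < e / 2 by lra.
have [N1 _ H1] := weyl_upper hy (ltW uv) e2.
have [N2 _ H2] := weyl_upper hy u0 e2.
have [N3 _ H3] := weyl_upper hy v1 e2.
exists (N1 + N2 + N3).+1 => //= N; rewrite /= => NN.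
have L1 : (N1 <= N)%N by lia.
have {}H1 := H1 N L1.
have L2 : (N2 <= N)%N by lia.
have {}H2 := H2 N L2.
have L3 : (N3 <= N)%N by lia.
have {}H3 := H3 N L3.
have N0 : (0 < N)%N by lia.
rewrite (in_arc_freqE y).
have : 1 <= cesaro (in_arc y 0 u) N + cesaro (in_arc y u v) N + cesaro (in_arc y v 1) N.
  rewrite -!cesaroD -[leLHS](@cesaro_cst _ N)//; apply: ler_cesaro => n.
  rewrite /in_arc -!natrD ler1n.
  have y0 : 0 <= y n by rewrite subr_ge0 floor_le.
  have y1 : y n <= 1 by rewrite lerBlDl ltW//; have /andP[_] := floor_itv (x n); rewrite intrD.
  rewrite y0 y1 andbT/=.
  by have [|ux] := leP (y n) u; have [|xv] := leP (y n) v; rewrite ?addn1//= ?(ltW ux) ?(ltW xv).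
by rewrite ler_norml => H4; apply/andP; split; lra.
Qed.

End Weyl.

(** * Differences of powers *)

Section Powers.
Context {R : realType}.
Implicit Types (x y a b : R) (n j : nat).

Lemma dist_expr_le b x y n : 1 <= b -> `|x| <= b -> `|y| <= b ->
  `|x ^+ n - y ^+ n| <= n%:R * b ^+ n * `|x - y|.
Proof.
move=> b1 xb yb; elim: n => [|n IH]; first by rewrite !expr0 subrr normr0 !mul0r.
have b0 : 0 <= b by lra.
have -> : x ^+ n.+1 - y ^+ n.+1 = x * (x ^+ n - y ^+ n) + y ^+ n * (x - y).
  by rewrite !exprS; ring.
apply: le_trans (ler_normD _ _) _; rewrite !normrM.
have H1 : `|x| * `|x ^+ n - y ^+ n| <= b * (n%:R * b ^+ n * `|x - y|) by rewrite ler_pM.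
have H2 : `|y ^+ n| * `|x - y| <= b ^+ n.+1 * `|x - y|.
  rewrite ler_wpM2r// normrX; apply: (@le_trans _ _ (b ^+ n)); first by rewrite lerXn2r ?nnegrE.
  by rewrite exprS ler_peMl// exprn_ge0.
apply: le_trans (lerD H1 H2) _.
by rewrite -(natr1 n) exprS le_eqVlt; apply/orP; left; apply/eqP; ring.
Qed.

Lemma taylor2_expr_le b x y n : 1 <= b -> `|x| <= b -> `|y| <= b ->
  `|x ^+ n - y ^+ n - n%:R * y ^+ n.-1 * (x - y)| <= n%:R ^+ 2 * b ^+ n * (x - y) ^+ 2.
Proof.
move=> b1 xb yb; have b0 : 0 <= b by lra.
elim: n => [|n IH]; first by rewrite !expr0 subrr !mul0r subrr normr0 expr0n/= !mul0r.
have E : n%:R * y ^+ n = n%:R * (y * y ^+ n.-1).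
  by case: n {IH} => [|n]; rewrite ?mul0r// exprS.
have -> : x ^+ n.+1 - y ^+ n.+1 - n.+1%:R * y ^+ n.+1.-1 * (x - y) =
   x * (x ^+ n - y ^+ n - n%:R * y ^+ n.-1 * (x - y)) + n%:R * y ^+ n.-1 * (x - y) ^+ 2.
  rewrite /= -(natr1 n) mulrDl E !exprS; ring.
apply: le_trans (ler_normD _ _) _; rewrite normrM.
have H1 : `|x| * `|x ^+ n - y ^+ n - n%:R * y ^+ n.-1 * (x - y)| <=
   b * (n%:R ^+ 2 * b ^+ n * (x - y) ^+ 2) by rewrite ler_pM.
have H2 : `|n%:R * y ^+ n.-1 * (x - y) ^+ 2| <= n%:R * b ^+ n.+1 * (x - y) ^+ 2.
  rewrite normrM normrM normr_nat (ger0_norm (sqr_ge0 _)) ler_wpM2r ?sqr_ge0//.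
  rewrite ler_wpM2l// normrX; apply: (@le_trans _ _ (b ^+ n.-1)).
    by rewrite lerXn2r ?nnegrE.
  by rewrite ler_weXn2l//; lia.
apply: le_trans (lerD H1 H2) _.
rewrite -(natr1 n) (exprS b n).
have := exprn_ge0 n b0; have := sqr_ge0 (x - y); have := ler0n R n.
set N := n%:R; set B := b ^+ n; set d := (x - y) ^+ 2 => N0 d0 B0.
rewrite -subr_ge0 [X in 0 <= X](_ : _ = (N + 1) * ((b * B) * d)); last by ring.
by apply: mulr_ge0; [lra|apply: mulr_ge0 => //; apply: mulr_ge0].
Qed.

Lemma expr_growth a x y n : 1 <= a -> a <= y -> y <= x ->
  n%:R * a ^+ n.-1 * (x - y) <= x ^+ n - y ^+ n.
Proof.
move=> a1 ay yx; elim: n => [|n IH]; first by rewrite !mul0r !expr0 subrr.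
have a0 : 0 <= a by lra.
have [n0|n0] := posnP n; first by rewrite n0 !expr1 expr0 mulr1 mul1r.
have -> : x ^+ n.+1 - y ^+ n.+1 = x * (x ^+ n - y ^+ n) + y ^+ n * (x - y).
  by rewrite !exprS; ring.
have xy0 : 0 <= x - y by lra.
have H1 : a * (n%:R * a ^+ n.-1 * (x - y)) <= x * (x ^+ n - y ^+ n).
  by rewrite ler_pM// ?mulr_ge0 ?exprn_ge0//; lra.
have H2 : a ^+ n * (x - y) <= y ^+ n * (x - y).
  by rewrite ler_wpM2r// lerXn2r// nnegrE//; lra.
apply: le_trans (lerD H1 H2).
have E : a ^+ n = a * a ^+ n.-1 by rewrite -exprS prednK.
by rewrite -(natr1 n) /= E le_eqVlt; apply/orP; left; apply/eqP; ring.
Qed.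

(** The derivative of [x ^ n - x ^ j]. *)
Definition dpow_diff n j x : R := n%:R * x ^+ n.-1 - j%:R * x ^+ j.-1.

(** Convexity of [x ^ n - x ^ j] on [[a, +oo)], uniform in [j < n]: the increment
    of [x ^ (j - 1)] is at most that of [x ^ (n - 1)] since [x >= 1], and its
    coefficient [j] is smaller than [n]. *)
Lemma dpow_diff_growth a x y n j : 1 <= a -> a <= y -> y <= x -> (j < n)%N -> (1 < n)%N ->
  a ^+ n.-2 * (x - y) <= dpow_diff n j x - dpow_diff n j y.
Proof.
move=> a1 ay yx jn n1; rewrite /dpow_diff.
have y1 : 1 <= y by lra.
have D0 : 0 <= x ^+ n.-1 - y ^+ n.-1.
  by rewrite subr_ge0 lerXn2r ?nnegrE//; lra.
have jle : j%:R * (x ^+ j.-1 - y ^+ j.-1) <= j%:R * (x ^+ n.-1 - y ^+ n.-1).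
  rewrite ler_wpM2l//.
  have jn' : (j.-1 <= n.-1)%N by lia.
  rewrite -(subnKC jn') !exprD; set k := (_ - _)%N.
  have x1 : 1 <= x ^+ k by rewrite exprn_ege1//; lra.
  have yk : y ^+ k <= x ^+ k by rewrite lerXn2r ?nnegrE//; lra.
  have xy : y ^+ j.-1 <= x ^+ j.-1 by rewrite lerXn2r ?nnegrE//; lra.
  have : 0 <= y ^+ j.-1 by rewrite exprn_ge0//; lra.
  nra.
have njR : j%:R + 1 <= n%:R :> R by rewrite natr1 ler_nat.
have G := expr_growth n.-1 a1 ay yx.
have n1R : 1 <= n.-1%:R :> R by rewrite ler1n; lia.
have : a ^+ n.-2 * (x - y) <= n.-1%:R * a ^+ n.-2 * (x - y).
  by rewrite -mulrA ler_peMl// mulr_ge0 ?exprn_ge0//; lra.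
nra.
Qed.

End Powers.

(** * Words, cylinders and their information content *)

(** Defined by recursion so that sums over words unfold one letter at a time. *)
Fixpoint word (A : finType) (m : nat) : finType :=
  if m is k.+1 then (A * word A k)%type : finType else unit.

Lemma sum_wordS (V : nmodType) (A : finType) m (F : word A m.+1 -> V) :
  \sum_w F w = \sum_(i : A) \sum_(w : word A m) F (i, w).
Proof. by rewrite pair_bigA/=; apply: eq_bigr => -[]. Qed.

Lemma sum_word0 (V : nmodType) (A : finType) (F : word A 0 -> V) : \sum_w F w = F tt.
Proof. by rewrite (big_pred1 tt)//; case. Qed.

Section Words.
Context {R : realType} {A : finType} (r : R) (t : A -> R) (p : A -> R).

Fixpoint wmap (m : nat) : word A m -> R -> R :=
  if m is k.+1 then fun w y => similarity r (t w.1) (wmap w.2 y) else fun _ y => y.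

Fixpoint wprob (m : nat) : word A m -> R :=
  if m is k.+1 then fun w => p w.1 * wprob w.2 else fun _ => 1.

(** Minus the logarithm of the probability of the word, as a sum over its letters; a
    letter of probability 0 counts for 0 because [ln 0 = 0]. *)
Fixpoint winfo (m : nat) : word A m -> R :=
  if m is k.+1 then fun w => - ln (p w.1) + winfo w.2 else fun _ => 0.

Lemma wmapB m (w : word A m) x y : wmap w x - wmap w y = r ^+ m * (x - y).
Proof.
elim: m w => [|m IH] w; first by rewrite mul1r.
by rewrite /= /similarity exprS -mulrA -(IH w.2); ring.
Qed.

Lemma wmap_affine m (w : word A m) x : wmap w x = similarity (r ^+ m) (wmap w 0) x.
Proof. by rewrite /similarity -[x in RHS]subr0 -(wmapB w) subrK. Qed.

Lemma wmap_stable (I : set R) : (forall i x, I x -> I (similarity r (t i) x)) ->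
  forall m (w : word A m) x, I x -> I (wmap w x).
Proof. by move=> h; elim=> [//|m IH] w x Ix /=; apply/h/IH. Qed.

(** After the longest common prefix, of length less than [m], the next letters
    separate the points by [g]; the prefix scales this by at least [|r| ^ m]. *)
Lemma wmap_separated (I : set R) (g : R) : `|r| <= 1 -> 0 <= g ->
  (forall i x, I x -> I (similarity r (t i) x)) ->
  (forall i j x y, i != j -> I x -> I y ->
    g <= `|similarity r (t i) x - similarity r (t j) y|) ->
  forall m (w w' : word A m) x y, w != w' -> I x -> I y ->
    g * `|r| ^+ m <= `|wmap w x - wmap w' y|.
Proof.
move=> r1 g0 stab sep; elim=> [[] []//|m IH] [i w] [j w'] x y ww' Ix Iy /=.
case: (eqVneq i j) ww' => [<-|ij] ww'; last first.
  apply: le_trans (sep _ _ _ _ ij (wmap_stable stab w Ix) (wmap_stable stab w' Iy)).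
  by rewrite ler_piMr// exprn_ile1.
have {}ww' : w != w' by apply: contra ww' => /eqP->.
have -> : similarity r (t i) (wmap w x) - similarity r (t i) (wmap w' y) =
    r * (wmap w x - wmap w' y) by rewrite /similarity; ring.
by rewrite normrM exprS mulrCA ler_wpM2l// IH.
Qed.

Context (hp : probability_vector p).

Lemma wprob_ge0 m (w : word A m) : 0 <= wprob w.
Proof. by elim: m w => [//|m IH] w /=; rewrite mulr_ge0//; case: hp. Qed.

Lemma sum_wprob m : \sum_(w : word A m) wprob w = 1.
Proof.
elim: m => [|m IH]; first by rewrite sum_word0.
rewrite sum_wordS /=; under eq_bigr do rewrite -mulr_sumr IH mulr1.
by case: hp.
Qed.

Lemma sum_word_cat m k (G : R -> R) y :
  \sum_(w : word A (m + k)) wprob w * G (wmap w y) =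
  \sum_(a : word A m) \sum_(b : word A k) wprob a * wprob b * G (wmap a (wmap b y)).
Proof.
elim: m G => [|m IH] G.
  by rewrite sum_word0; apply: eq_bigr => b _; rewrite mul1r.
rewrite [LHS](@sum_wordS _ _ (m + k)) [RHS]sum_wordS; apply: eq_bigr => i _.
have := congr1 ( *%R (p i)) (IH (fun z => G (similarity r (t i) z))).
rewrite !mulr_sumr => E; rewrite [LHS](_ : _ = \sum_(w : word A (m + k))
    p i * (wprob w * G (similarity r (t i) (wmap w y)))); last first.
  by apply: eq_bigr => w _; rewrite /= mulrA.
rewrite E; apply: eq_bigr => a _; rewrite mulr_sumr; apply: eq_bigr => b _.
by rewrite /= !mulrA.
Qed.

(** An inequality only: if some letter has probability 0, the left side vanishes while
    that letter contributes nothing to [winfo]. *)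
Lemma wprob_le_expR m (w : word A m) : wprob w <= expR (- winfo w).
Proof.
elim: m w => [|m IH] w /=; first by rewrite oppr0 expR0.
rewrite opprD opprK expRD ler_pM ?wprob_ge0//; first by case: hp.
have [p0|p0] := ltP 0 (p w.1); first by rewrite lnK.
by rewrite (le_trans p0)// expR_ge0.
Qed.

Definition info_variance : R := \sum_(i : A) p i * (- ln (p i) - entropy p) ^+ 2.

Lemma info_variance_ge0 : 0 <= info_variance.
Proof. by apply: sumr_ge0 => i _; rewrite mulr_ge0 ?sqr_ge0//; case: hp. Qed.

(** The letters of a random word are independent with mean information [entropy p], so
    means and variances add up. *)
Lemma winfo_mean m : \sum_(w : word A m) wprob w * (winfo w - m%:R * entropy p) = 0.
Proof.
elim: m => [|m IH]; first by rewrite sum_word0 mul0r subrr mulr0.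
rewrite sum_wordS /=.
rewrite (eq_bigr (fun i => p i * (- ln (p i) - entropy p))); last first.
  move=> i _; rewrite -[RHS]mulr1 -[X in _ = _ * X](sum_wprob m).
  rewrite -[RHS]addr0 -[X in _ = _ + X](mulr0 (p i)) -[X in _ = _ + _ * X]IH.
  rewrite !mulr_sumr -big_split/=; apply: eq_bigr => w _.
  by rewrite -(natr1 m); ring.
under eq_bigr do rewrite mulrBr mulrN.
rewrite sumrB sumrN -mulr_suml; case: hp => _ ->.
by rewrite /entropy mul1r subrr.
Qed.

Lemma winfo_variance m :
  \sum_(w : word A m) wprob w * (winfo w - m%:R * entropy p) ^+ 2 = m%:R * info_variance.
Proof.
elim: m => [|m IH]; first by rewrite sum_word0 mul0r subrr expr0n/= mulr0 mul0r.
rewrite sum_wordS /=.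
rewrite (eq_bigr (fun i => p i * (- ln (p i) - entropy p) ^+ 2 + p i * (m%:R * info_variance))).
  rewrite big_split/= -mulr_suml; case: hp => _ ->.
  by rewrite -(natr1 m) /info_variance; ring.
move=> i _.
rewrite -IH -[X in X + _]mulr1 -[X in _ * X + _](sum_wprob m).
rewrite -[RHS]addr0 -[X in _ = _ + X](mulr0 (2 * p i * (- ln (p i) - entropy p))).
rewrite -[X in _ = _ + _ * X](winfo_mean m).
rewrite !mulr_sumr -!big_split/=; apply: eq_bigr => w _.
by rewrite -(natr1 m); ring.
Qed.

(** Chebyshev's inequality for the information content of a random word. *)
Lemma atypical_mass m (eta : R) : (0 < m)%N -> 0 < eta ->
  \sum_(w : word A m | winfo w < m%:R * (entropy p - eta)) wprob w
  <= info_variance / (eta ^+ 2 * m%:R).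
Proof.
move=> m0 eta0; have mR : 0 < m%:R :> R by rewrite ltr0n.
have -> : info_variance / (eta ^+ 2 * m%:R) =
    (eta * m%:R) ^- 2 * (m%:R * info_variance).
  by field; rewrite !gt_eqF.
rewrite -winfo_variance mulr_sumr big_mkcond/=; apply: ler_sum => w _.
case: ifP => [bad|_]; last first.
  by rewrite mulr_ge0 ?invr_ge0 ?sqr_ge0// mulr_ge0 ?wprob_ge0 ?sqr_ge0.
rewrite mulrCA ler_peMr ?wprob_ge0// mulrC ler_pdivlMr ?exprn_gt0 ?mulr_gt0// mul1r.
rewrite -[leRHS]sqrrN lerXn2r ?nnegrE//; last by nra.
  by rewrite mulr_ge0 ?ltW.
by move: bad; rewrite mulrBr; nra.
Qed.

End Words.

(** * Bilinear exponential sums with separated frequencies *)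

Section BilinearReal.
Context {R : realType}.

(** Rounding frequencies and positions down to grids of meshes [sg] and [tau] with
    [sg * tau = 2 pi / M] turns the phases [xi i * y j] into those of the discrete
    Fourier transform of order [M]; separation keeps the rounded points distinct. *)
Lemma bilinear_sum_separated (I : finType) (u v c xi y : I -> R) (M : nat)
    (Xi sg0 tau D B : R) :
  (forall i, 0 <= u i) -> (forall i, 0 <= v i) ->
  \sum_i u i <= 1 -> \sum_i v i <= 1 ->
  0 <= Xi -> 0 <= D -> 0 < tau -> (2 < M)%N -> Xi * tau <= 1 -> D < M%:R * tau ->
  pi *+ 2 / (M%:R * tau) <= sg0 ->
  (forall i, `|xi i| <= Xi) -> (forall i, 0 <= y i <= D) ->
  (forall i j, i != j -> sg0 <= `|xi i - xi j|) ->
  (forall i j, i != j -> tau <= `|y i - y j|) ->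
  0 <= B -> M%:R * (\sum_i u i ^+ 2) * (\sum_i v i ^+ 2) <= B ^+ 2 ->
  `|\sum_i \sum_j u i * v j * cos (c i + xi i * y j)| <= B + (sg0 * D + Xi * tau).
Proof.
move=> u0 v0 su sv Xi0 D0 tau0 M2 Xt DM sgsg0 hxi hy sepxi sepy B0 hB.
have MR : 2 < M%:R :> R by rewrite (ltr_nat _ 2).
have p2 := @pi_ge2 R.
(* The mesh of the frequencies; it is at most [sg0], and that of the positions is
   [tau]. *)
pose sg : R := pi *+ 2 / (M%:R * tau).
have sg_gt0 : 0 < sg by rewrite divr_gt0 ?mulr_gt0//; lra.
have sgtau : sg * tau = pi *+ 2 / M%:R by rewrite /sg; field; rewrite !gt_eqF//; lra.
pose z i : int := Num.floor (xi i / sg).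
pose kk j : nat := Num.truncn (y j / tau).
have yt0 j : 0 <= y j / tau by rewrite divr_ge0 ?(ltW tau0)//; case/andP: (hy j).
have kkM j : (kk j < M)%N.
  have /andP[k1 _] := truncn_itv (yt0 j).
  rewrite -(ltr_nat R); apply: (le_lt_trans k1).
  by rewrite ltr_pdivrMr//; apply: le_lt_trans DM; case/andP: (hy j).
pose k j : 'I_M := Ordinal (kkM j).
have kinj : injective k.
  move=> i j /(congr1 val)/= E; apply/eqP/negPn/negP => /sepy.
  rewrite leNgt => /negP; apply.
  have /andP[a1 a2] := truncn_itv (yt0 i); have /andP[b1 b2] := truncn_itv (yt0 j).
  move: a1 a2 b1 b2; rewrite -/(kk i) -/(kk j) E -natr1.
  rewrite !ler_pdivlMr// !ltr_pdivrMr// => a1 a2 b1 b2.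
  by rewrite ltr_norml; apply/andP; split; lra.
have zsep i j : i != j -> (0 < `|z i - z j| < M)%N.
  move=> ij; apply/andP; split.
    rewrite absz_gt0 subr_eq0; apply/negP => /eqP E.
    move: (sepxi _ _ ij); rewrite leNgt => /negP; apply; apply: lt_le_trans sgsg0.
    have /andP[a1 a2] := floor_itv (xi i / sg); have /andP[b1 b2] := floor_itv (xi j / sg).
    move: a1 a2 b1 b2; rewrite -/(z i) -/(z j) E intrD/=.
    rewrite !ler_pdivlMr// !ltr_pdivrMr// => a1 a2 b1 b2.
    by rewrite ltr_norml -/sg; apply/andP; split; lra.
  rewrite -(ltr_nat R) natr_absz intr_norm intrB.
  have /andP[a1 a2] := floor_itv (xi i / sg); have /andP[b1 b2] := floor_itv (xi j / sg).
  move: a1 a2 b1 b2; rewrite -/(z i) -/(z j) !intrD/= => a1 a2 b1 b2.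
  have H i' : `|xi i' / sg| <= M%:R / 4.
    rewrite normrM [X in _ * X]gtr0_norm ?invr_gt0// ler_pdivrMr//.
    apply: (le_trans (hxi i')); rewrite -(@ler_pM2r _ tau)//.
    rewrite -mulrA sgtau; apply: (le_trans Xt).
    have -> : M%:R / 4 * (pi *+ 2 / M%:R) = pi / 2 :> R by field; rewrite gt_eqF//; lra.
    lra.
  move: (H i) (H j); rewrite !ler_norml => /andP[h1 h2] /andP[h3 h4].
  by rewrite ltr_norml; apply/andP; split; lra.
have main := bilinear_sum_Zmod u v c kinj zsep.
set S' := (X in X ^+ 2 <= _) in main.
have S'B : `|S'| <= B.
  rewrite -(@ler_pXn2r _ 2)// ?nnegrE// real_normK ?num_real//.
  exact: le_trans main hB.
(* The rounding errors in [xi] and [y] change the phase by at most [sg0 * D] and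
   [Xi * tau]. *)
set S := \sum_i _.
have SS' : `|S - S'| <= sg0 * D + Xi * tau.
  rewrite /S /S' -sumrB; apply: (le_trans (ler_norm_sum _ _ _)).
  apply: (@le_trans _ _ (\sum_i \sum_j u i * v j * (sg0 * D + Xi * tau))).
    apply: ler_sum => i _; rewrite -sumrB; apply: (le_trans (ler_norm_sum _ _ _)).
    apply: ler_sum => j _; rewrite -mulrBr normrM ger0_norm ?mulr_ge0// ler_wpM2l ?mulr_ge0//.
    apply: (le_trans (dist_cos _ _)).
    have -> : (z i)%:~R * (pi *+ 2) / M%:R = (z i)%:~R * sg * tau.
      by rewrite -mulrA -(mulrA (z i)%:~R) sgtau.
    have -> : c i + xi i * y j - (c i + (k j)%:R * ((z i)%:~R * sg * tau)) =
       xi i * (y j - (kk j)%:R * tau) + (xi i - (z i)%:~R * sg) * ((kk j)%:R * tau).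
      by rewrite /k/=; ring.
    apply: (le_trans (ler_normD _ _)); rewrite addrC !normrM.
    have /andP[a1 a2] := floor_itv (xi i / sg); have /andP[b1 b2] := truncn_itv (yt0 j).
    move: a1 a2 b1 b2; rewrite -/(z i) -/(kk j) intrD/= -natr1.
    rewrite !ler_pdivlMr// !ltr_pdivrMr// => a1 a2 b1 b2.
    case/andP: (hy j) => y0 yD.
    apply: lerD; apply: ler_pM => //.
    - by rewrite ger0_norm; [apply: le_trans sgsg0; rewrite -/sg; lra|lra].
    - by rewrite normr_nat (gtr0_norm tau0); lra.
    - by rewrite ger0_norm; lra.
  have E0 : 0 <= sg0 * D + Xi * tau.
    by rewrite addr_ge0// mulr_ge0 ?(ltW tau0)// (le_trans (ltW sg_gt0)).
  under eq_bigr do rewrite -mulr_suml -mulr_sumr.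
  rewrite -mulr_suml -mulr_suml.
  rewrite -[leRHS]mul1r ler_wpM2r// mulr_ile1 ?sumr_ge0//.
have -> : S = S' + (S - S') by ring.
by apply: (le_trans (ler_normD _ _)); rewrite lerD.
Qed.

End BilinearReal.

(** * Oscillatory sums over the words of one level *)

Section LevelBound.
Context {R : realType} {A : finType} (r : R) (t : A -> R) (p : A -> R).
Context (al be g : R).

(** All that the argument uses of the iterated function system: the interval
    [[al, be]] stands for the convex hull of the self-similar set. *)
Record separated_system : Prop := SeparatedSystem {
  ss_prob : probability_vector p;
  ss_ratio : 0 < `|r| < 1;
  ss_le : al <= be;
  ss_stable : forall i x, al <= x <= be -> al <= similarity r (t i) x <= be;
  ss_gap : 0 < g;
  ss_sep : forall i j x y, i != j -> al <= x <= be -> al <= y <= be ->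
    g <= `|similarity r (t i) x - similarity r (t j) y| }.

(** The integral of [cos F] with respect to the self-similar measure, discretized at
    level [m]. *)
Definition phase_mean (F : R -> R) m : R :=
  \sum_(w : word A m) wprob p w * cos (F (wmap r t w al)).

Context (ss : separated_system).
Let D := be - al.

Let al_in : al <= al <= be.
Proof. by rewrite lexx; case: ss. Qed.

Let D0 : 0 <= D.
Proof. by rewrite subr_ge0; case: ss. Qed.

Lemma wmap_in m (w : word A m) x : al <= x <= be -> al <= wmap r t w x <= be.
Proof. by apply: (@wmap_stable R A r t [set x | al <= x <= be]) => // i y; case: ss => _ _ _ h _ _; apply: h. Qed.

Lemma wmap_dist m (w : word A m) x y : `|wmap r t w x - wmap r t w y| = `|r| ^+ m * `|x - y|.
Proof. by rewrite wmapB normrM normrX. Qed.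

Lemma wmap_sep m (w w' : word A m) x y : w != w' -> al <= x <= be -> al <= y <= be ->
  g * `|r| ^+ m <= `|wmap r t w x - wmap r t w' y|.
Proof.
case: ss => _ /andP[_ r1] _ st g0 sp; apply: (@wmap_separated _ _ _ _ [set x | al <= x <= be]) => //.
- exact: ltW.
- exact: ltW.
Qed.

Let wp0 m (w : word A m) : 0 <= wprob p w.
Proof. by apply: wprob_ge0; case: ss. Qed.

Let wp1 m : \sum_(w : word A m) wprob p w = 1.
Proof. by apply: sum_wprob; case: ss. Qed.

(** A word of length [m + (m + k)] is split as [u v w].  Since [phi_u] contracts by
    [|r| ^ m], the second order Taylor remainder is at most [K2 (|r| ^ m D) ^ 2]; and
    replacing [phi_v (phi_w al)] by [phi_v al] in the linear term costs
    [|r| ^ m K1] times [|r| ^ m D]. *)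
Lemma phase_mean_linearize (F F1 : R -> R) (K1 K2 : R) m k :
  0 <= K2 ->
  (forall x y, al <= x <= be -> al <= y <= be ->
     `|F x - F y - F1 y * (x - y)| <= K2 * (x - y) ^+ 2) ->
  (forall y, al <= y <= be -> `|F1 y| <= K1) ->
  `|phase_mean F (m + (m + k)) -
    \sum_(a : word A m) \sum_(b : word A m) wprob p a * wprob p b *
      cos (F (wmap r t a al) + r ^+ m * F1 (wmap r t a al) * (wmap r t b al - al))|
  <= (`|r| ^+ m) ^+ 2 * (K2 * D ^+ 2 + K1 * D).
Proof.
move=> K20 hF hF1; rewrite /phase_mean.
rewrite (sum_word_cat r t p m (m + k) (fun y => cos (F y))).
rewrite -sumrB; apply: (le_trans (ler_norm_sum _ _ _)).
set Er := (X in _ <= X).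
rewrite -[Er]mul1r -(wp1 m) mulr_suml; apply: ler_sum => a _.
have E1 := sum_word_cat r t p m k (fun y => cos (F (wmap r t a y))) al.
rewrite (eq_bigr (fun b => wprob p a * (wprob p b * cos (F (wmap r t a (wmap r t b al)))))); last first.
  by move=> b _; rewrite mulrA.
rewrite -mulr_sumr E1.
rewrite [X in _ - X](_ : _ = wprob p a * \sum_(b : word A m) \sum_(c : word A k)
   wprob p b * wprob p c *
   cos (F (wmap r t a al) + r ^+ m * F1 (wmap r t a al) * (wmap r t b al - al))); last first.
  rewrite mulr_sumr; apply: eq_bigr => b _.
  by rewrite -mulr_suml -mulr_sumr wp1 mulr1 mulrA.
rewrite -mulrBr normrM ger0_norm// ler_wpM2l//.
rewrite -sumrB; apply: (le_trans (ler_norm_sum _ _ _)).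
rewrite -[Er]mul1r -(wp1 m) mulr_suml; apply: ler_sum => b _.
rewrite -sumrB; apply: (le_trans (ler_norm_sum _ _ _)).
rewrite -[Er]mul1r -(wp1 k) mulr_suml mulr_sumr; apply: ler_sum => c _.
rewrite -mulrBr normrM ger0_norm ?mulr_ge0// [leRHS]mulrA ler_wpM2l ?mulr_ge0//.
apply: (le_trans (dist_cos _ _)).
set z := wmap r t c al; set y := wmap r t b z.
have zin : al <= z <= be by apply: wmap_in.
have yin : al <= y <= be by apply: wmap_in.
have bin : al <= wmap r t b al <= be by apply: wmap_in.
have ain : al <= wmap r t a al <= be by apply: wmap_in.
have ayin : al <= wmap r t a y <= be by apply: wmap_in.
rewrite [X in `|X|](_ : _ = (F (wmap r t a y) - F (wmap r t a al) -
     F1 (wmap r t a al) * (wmap r t a y - wmap r t a al)) +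
     r ^+ m * F1 (wmap r t a al) * (y - wmap r t b al)); last first.
  by rewrite wmapB; ring.
apply: (le_trans (ler_normD _ _)); rewrite /Er [leRHS]mulrDr; apply: lerD.
  apply: (le_trans (hF _ _ ayin ain)); rewrite wmapB exprMn mulrCA.
  have -> : (r ^+ m) ^+ 2 = (`|r| ^+ m) ^+ 2.
    by rewrite -[LHS]real_normK ?num_real// normrX.
  rewrite ler_wpM2l ?sqr_ge0// ler_wpM2l//.
  by rewrite lerXn2r ?nnegrE//; [lra|rewrite /D; lra].
rewrite !normrM normrX wmap_dist.
rewrite [leRHS](_ : _ = `|r| ^+ m * K1 * (`|r| ^+ m * D)); last by rewrite expr2; ring.
have zD : `|z - al| <= D by rewrite ger0_norm /D; lra.
by apply: ler_pM => //; apply: ler_pM => //; apply: hF1.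
Qed.

(** The three terms come from the atypical words, from the bilinear form restricted to
    the typical ones, and from the linearization and rounding errors.  Frequencies are
    separated by [K0 g |r| ^ (2 m)] and positions by [g |r| ^ m], which determines the
    order [M] of the Fourier transform. *)
Lemma phase_mean_level (F F1 : R -> R) (K0 K1 K2 eta : R) m k :
  0 < K0 -> 0 <= K1 -> 0 <= K2 -> 0 < eta -> (0 < m)%N ->
  (forall x y, al <= x <= be -> al <= y <= be ->
     `|F x - F y - F1 y * (x - y)| <= K2 * (x - y) ^+ 2) ->
  (forall y, al <= y <= be -> `|F1 y| <= K1) ->
  (forall x y, al <= x <= be -> al <= y <= be -> K0 * `|x - y| <= `|F1 x - F1 y|) ->
  let Q := `|r| ^+ m in
  K1 * g * Q ^+ 2 <= 1 ->
  `|phase_mean F (m + (m + k))| <=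
    2 * (info_variance p / (eta ^+ 2 * m%:R)) +
    expR (- (m%:R * (entropy p - eta))) *
      Num.sqrt (pi *+ 2 / (K0 * g ^+ 2 * Q ^+ 3) + D / (g * Q) + 4) +
    Q ^+ 2 * (K2 * D ^+ 2 + K1 * D + K0 * g * D + K1 * g).
Proof.
move=> K00 K10 K20 eta0 m0 hF hF1 hF0 Q KQ.
have [hp /andP[r0 r1] _ _ g0 _] := ss.
have Q0 : 0 < Q by rewrite exprn_gt0.
(* Both weights in the bilinear form are cut off to the typical words. *)
pose good (w : word A m) := ~~ (winfo p w < m%:R * (entropy p - eta)).
pose u w := wprob p w * (good w)%:R.
have u0 w : 0 <= u w by rewrite mulr_ge0.
have uP w : u w <= wprob p w by rewrite ler_piMr// lern1 leq_b1.
have su : \sum_w u w <= 1 by rewrite -(wp1 m); apply: ler_sum.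
pose Pm := expR (- (m%:R * (entropy p - eta))).
have uPm w : u w <= Pm.
  rewrite /u /good; case: ltP => [_|H]; rewrite ?mulr0 ?expR_ge0// mulr1.
  by apply: (le_trans (wprob_le_expR hp w)); rewrite ler_expR lerN2.
have su2 : \sum_w u w ^+ 2 <= Pm.
  rewrite -[leRHS]mulr1; apply: (@le_trans _ _ (Pm * \sum_w u w)).
    by rewrite mulr_sumr; apply: ler_sum => w _; rewrite expr2 ler_wpM2r.
  by rewrite ler_wpM2l ?expR_ge0.
(* The three terms of [C0] make the mesh of the frequencies at most their separation,
   the positions distinct modulo [M], and [M > 2]. *)
pose C0 := pi *+ 2 / (K0 * g ^+ 2 * Q ^+ 3) + D / (g * Q) + 3.
have den0 : 0 < K0 * g ^+ 2 * Q ^+ 3 by rewrite !mulr_gt0 ?exprn_gt0.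
have hyp1 : 0 <= pi *+ 2 / (K0 * g ^+ 2 * Q ^+ 3) :> R.
  by rewrite divr_ge0 ?(ltW den0)// mulrn_wge0 ?pi_ge0.
have hyp2 : 0 <= D / (g * Q) by rewrite divr_ge0// mulr_ge0// ltW.
have C00 : 0 <= C0 by rewrite /C0; lra.
pose M := (Num.truncn C0).+1.
have /andP[M1 M2] := truncn_itv C00; rewrite -/M in M2.
have M3 : 3 < M%:R :> R by apply: le_lt_trans M2; rewrite /C0; lra.
have MD : D < M%:R * (g * Q).
  by rewrite -ltr_pdivrMr ?mulr_gt0//; apply: le_lt_trans M2; rewrite /C0; lra.
have Msg : pi *+ 2 / (M%:R * (g * Q)) <= K0 * Q * (g * Q).
  rewrite ler_pdivrMr ?mulr_gt0//.
  rewrite [leRHS](_ : _ = M%:R * (K0 * g ^+ 2 * Q ^+ 3)); last by ring.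
  rewrite -ler_pdivrMr//; apply: ltW; apply: le_lt_trans M2.
  by rewrite /C0; lra.
pose c (a : word A m) := F (wmap r t a al).
pose xi (a : word A m) := r ^+ m * F1 (wmap r t a al).
pose y (b : word A m) := wmap r t b al - al.
have win (w : word A m) : al <= wmap r t w al <= be by apply: wmap_in.
have S2 : `|\sum_a \sum_b u a * u b * cos (c a + xi a * y b)| <=
    Num.sqrt M%:R * Pm + (K0 * Q * (g * Q) * D + K1 * Q * (g * Q)).
  apply: (@bilinear_sum_separated R _ u u c xi y M) => //.
  - by rewrite mulr_ge0// ltW.
  - by rewrite mulr_gt0.
  - by rewrite -(ltr_nat R); lra.
  - by rewrite [leLHS](_ : _ = K1 * g * Q ^+ 2)//; ring.
  - by move=> a; rewrite normrM normrX mulrC ler_wpM2r ?hF1// ltW.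
  - by move=> b; rewrite /y subr_ge0 lerD2r; case/andP: (win b) => -> ->.
  - move=> a a' aa'; rewrite /xi -mulrBr normrM normrX -/Q.
    rewrite [leLHS](_ : _ = Q * (K0 * (g * Q))); last by ring.
    rewrite ler_wpM2l ?(ltW Q0)//; apply: le_trans (hF0 _ _ (win a) (win a')).
    by rewrite ler_wpM2l ?(ltW K00)// wmap_sep.
  - move=> b b' bb'; rewrite /y [X in `|X|](_ : _ = wmap r t b al - wmap r t b' al).
      by rewrite wmap_sep.
    by ring.
  - by rewrite mulr_ge0 ?sqrtr_ge0 ?expR_ge0.
  rewrite exprMn sqr_sqrtr// -mulrA ler_wpM2l// expr2.
  by apply: ler_pM => //; apply: sumr_ge0 => w _; rewrite sqr_ge0.
have S12 : `|\sum_a \sum_b wprob p a * wprob p b * cos (c a + xi a * y b) -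
     \sum_a \sum_b u a * u b * cos (c a + xi a * y b)| <=
     2 * (info_variance p / (eta ^+ 2 * m%:R)).
  apply: (@le_trans _ _ (2 * (\sum_w (wprob p w - u w)))); last first.
    rewrite ler_pM2l//; apply: le_trans (atypical_mass hp m0 eta0).
    rewrite [leRHS]big_mkcond/=; apply: ler_sum => w _; rewrite /u /good.
    by case: ifP => _ /=; rewrite ?mulr0 ?mulr1 ?subr0 ?subrr.
  rewrite -sumrB; apply: (le_trans (ler_norm_sum _ _ _)).
  apply: (@le_trans _ _ (\sum_(a : word A m) \sum_(b : word A m)
     (wprob p a * (wprob p b - u b) + (wprob p a - u a) * wprob p b))).
    apply: ler_sum => a _; rewrite -sumrB; apply: (le_trans (ler_norm_sum _ _ _)).
    apply: ler_sum => b _; rewrite -mulrBl normrM.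
    have := u0 a; have := u0 b; have := uP a; have := uP b => h1 h2 h3 h4.
    have E : 0 <= wprob p a * wprob p b - u a * u b by rewrite subr_ge0 ler_pM.
    rewrite (ger0_norm E); apply: (@le_trans _ _ (wprob p a * wprob p b - u a * u b)).
      by rewrite ler_piMr// cos_max.
    nra.
  under eq_bigr do rewrite big_split/= -!mulr_sumr wp1 mulr1.
  by rewrite big_split/= -mulr_suml wp1 mul1r mulr_natl mulr2n.
have S01 := phase_mean_linearize m k K20 hF hF1.
set S1 := (X in _ - X) in S01.
have E1 : S1 = \sum_a \sum_b wprob p a * wprob p b * cos (c a + xi a * y b) by [].
rewrite -E1 in S12.
have MC : Num.sqrt M%:R <= Num.sqrt (pi *+ 2 / (K0 * g ^+ 2 * Q ^+ 3) + D / (g * Q) + 4).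
  rewrite ler_wsqrtr// /M -natr1; apply: (@le_trans _ _ (C0 + 1)); first by rewrite lerD2r.
  by rewrite /C0; lra.
have MC2 := ler_wpM2r (expR_ge0 (- (m%:R * (entropy p - eta)))) MC.
rewrite -/Pm in MC2 *; rewrite [Pm * _]mulrC.
move: S01 S12 S2 MC2; rewrite -/Q.
set P0 := phase_mean _ _; set S2 := \sum_a \sum_b _.
move=> S01 S12 S2b MC2.
have -> : P0 = (P0 - S1) + (S1 - S2) + S2 by ring.
apply: (le_trans (ler_normD _ _)).
have := ler_normD (P0 - S1) (S1 - S2).
have -> : Q ^+ 2 * (K2 * D ^+ 2 + K1 * D + K0 * g * D + K1 * g) =
  Q ^+ 2 * (K2 * D ^+ 2 + K1 * D) + (K0 * Q * (g * Q) * D + K1 * Q * (g * Q)) by ring.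
lra.
Qed.

End LevelBound.

(** * The phases of the powers *)

Section PowerPhase.
Context {R : realType}.

Lemma expR_ge_sqr (x : R) : 0 <= x -> x ^+ 2 / 4 <= expR x.
Proof.
move=> x0; have -> : expR x = expR (x / 2) ^+ 2 by rewrite -expRM_natl; congr expR; field.
have := expR_ge1Dx (x / 2); set e := expR _ => H.
by have -> : x ^+ 2 / 4 = (x / 2) ^+ 2; [field|rewrite lerXn2r// ?nnegrE; lra].
Qed.

Lemma expR_ge_cube (x : R) : 0 <= x -> x ^+ 3 / 27 <= expR x.
Proof.
move=> x0; have -> : expR x = expR (x / 3) ^+ 3 by rewrite -expRM_natl; congr expR; field.
have := expR_ge1Dx (x / 3); set e := expR _ => H.
by have -> : x ^+ 3 / 27 = (x / 3) ^+ 3; [field|rewrite lerXn2r// ?nnegrE; lra].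
Qed.

Definition power_phase (l n j : nat) (rho s y : R) : R :=
  pi *+ 2 * l%:R * ((rho * y + s) ^+ n - (rho * y + s) ^+ j).

Definition power_phase_deriv (l n j : nat) (rho s y : R) : R :=
  pi *+ 2 * l%:R * rho * dpow_diff n j (rho * y + s).

Context (l n j : nat) (rho s a b al be : R).
Context (l0 : (0 < l)%N) (jn : (j < n)%N) (a1 : 1 <= a).
Context (hab : forall y, al <= y <= be -> a <= rho * y + s <= b).

Let L : R := pi *+ 2 * l%:R.
Let L0 : 0 < L.
Proof. by rewrite mulr_gt0 ?ltr0n// pmulrn_lgt0// pi_gt0. Qed.

Let Lr : 0 <= L * `|rho|.
Proof. by rewrite pmulr_rge0. Qed.

Lemma power_phase_taylor x y : al <= x <= be -> al <= y <= be ->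
  `|power_phase l n j rho s x - power_phase l n j rho s y - power_phase_deriv l n j rho s y * (x - y)|
  <= L * 2 * rho ^+ 2 * (n%:R ^+ 2 * b ^+ n) * (x - y) ^+ 2.
Proof.
move=> /hab/andP[ax xb] /hab/andP[ay yb]; rewrite /power_phase /power_phase_deriv /dpow_diff -/L.
set X := rho * x + s in ax xb *; set Y := rho * y + s in ay yb *.
have XY : X - Y = rho * (x - y) by rewrite /X /Y; ring.
rewrite [X in `|X|](_ : _ = L * ((X ^+ n - Y ^+ n - n%:R * Y ^+ n.-1 * (X - Y)) -
   (X ^+ j - Y ^+ j - j%:R * Y ^+ j.-1 * (X - Y)))); last by rewrite XY; ring.
rewrite normrM gtr0_norm//.
set T := n%:R ^+ 2 * b ^+ n * (X - Y) ^+ 2.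
rewrite [leRHS](_ : _ = L * (T + T)); last by rewrite /T XY; ring.
rewrite ler_pM2l//; apply: (le_trans (ler_normB _ _)).
have b1 : 1 <= b by exact: le_trans a1 (le_trans ax xb).
have nX : `|X| <= b by rewrite ger0_norm// (le_trans _ ax)// (le_trans _ a1).
have nY : `|Y| <= b by rewrite ger0_norm// (le_trans _ ay)// (le_trans _ a1).
apply: lerD; first exact: taylor2_expr_le.
apply: (le_trans (taylor2_expr_le j b1 nX nY)).
rewrite /T ler_wpM2r ?sqr_ge0//; apply: ler_pM; rewrite ?sqr_ge0 ?exprn_ge0//.
- by rewrite (le_trans _ b1).
- by rewrite lerXn2r ?nnegrE// ler_nat ltnW.
- by rewrite ler_weXn2l// ltnW.
Qed.

Lemma power_phase_deriv_le y : al <= y <= be ->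
  `|power_phase_deriv l n j rho s y| <= L * 2 * `|rho| * (n%:R ^+ 2 * b ^+ n).
Proof.
move=> /hab/andP[ay yb]; rewrite /power_phase_deriv /dpow_diff -/L.
set Y := rho * y + s in ay yb *.
set T := n%:R ^+ 2 * b ^+ n.
rewrite normrM (_ : `|L * rho| = L * `|rho|); last by rewrite normrM gtr0_norm.
rewrite [leRHS](_ : _ = L * `|rho| * (T + T)); last by ring.
rewrite (ler_wpM2l Lr)//; apply: (le_trans (ler_normB _ _)).
have b1 : 1 <= b by exact: le_trans a1 (le_trans ay yb).
have nY : `|Y| <= b by rewrite ger0_norm// (le_trans _ ay)// (le_trans _ a1).
have H k : (k <= n)%N -> `|k%:R * Y ^+ k.-1| <= T.
  move=> kn; rewrite normrM normr_nat normrX ler_pM ?exprn_ge0//.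
    by rewrite -natrX ler_nat (leq_trans kn)// -mulnn leq_pmulr// (leq_ltn_trans (leq0n j) jn).
  apply: (@le_trans _ _ (b ^+ k.-1)); first by rewrite lerXn2r ?nnegrE// (le_trans _ b1).
  by rewrite ler_weXn2l// (leq_trans (leq_pred k)).
by apply: lerD; apply: H => //; exact: ltnW.
Qed.

Lemma power_phase_deriv_growth x y : (1 < n)%N -> al <= x <= be -> al <= y <= be ->
  L * rho ^+ 2 * a ^+ n.-2 * `|x - y| <=
  `|power_phase_deriv l n j rho s x - power_phase_deriv l n j rho s y|.
Proof.
move=> n1 /hab/andP[ax _] /hab/andP[ay _]; rewrite /power_phase_deriv -/L.
set X := rho * x + s in ax *; set Y := rho * y + s in ay *.
have XY : X - Y = rho * (x - y) by rewrite /X /Y; ring.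
rewrite -mulrBr normrM (_ : `|L * rho| = L * `|rho|); last by rewrite normrM gtr0_norm.
rewrite -(real_normK (num_real rho)) expr2.
rewrite [leLHS](_ : _ = L * `|rho| * (a ^+ n.-2 * (`|rho| * `|x - y|))); last by ring.
rewrite -(normrM rho) -XY (ler_wpM2l Lr)//.
clear XY; move: X Y ax ay => X Y ax ay.
wlog YX : X Y ax ay / Y <= X.
  move=> W; have [YX|/ltW XY] := leP Y X; first exact: W.
  by rewrite distrC [leRHS]distrC; exact: W.
have G := dpow_diff_growth a1 ay YX jn n1.
rewrite (@ger0_norm _ (X - Y)) ?subr_ge0//; apply: (le_trans G); exact: ler_norm.
Qed.

End PowerPhase.

(** * Decay of the oscillatory sums *)

Ltac nonneg :=
  match goal with
  | _ : is_true (0 <= ?x) |- is_true (0 <= ?x) => assumption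
  | H : is_true (0 < ?x) |- is_true (0 <= ?x) => exact: (ltW H)
  | |- is_true (0 <= _ * _) => apply: mulr_ge0; nonneg
  | |- is_true (0 <= _ + _) => apply: addr_ge0; nonneg
  | |- is_true (0 <= _^-1) => rewrite invr_ge0; nonneg
  | |- is_true (0 <= _ ^+ 2) => exact: sqr_ge0
  | |- is_true (0 <= _ ^+ _) => apply: exprn_ge0; nonneg
  | |- is_true (0 <= `|_|) => exact: normr_ge0
  | |- is_true (0 <= expR _) => exact: expR_ge0
  | |- is_true (0 <= Num.sqrt _) => exact: sqrtr_ge0
  | |- is_true (0 <= _%:R) => exact: ler0n
  | |- is_true (0 <= _ *+ _) => apply: mulrn_wge0; nonneg
  | |- is_true (0 <= 1) => exact: ler01
  end.

Ltac posit :=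
  match goal with
  | _ : is_true (0 < ?x) |- is_true (0 < ?x) => assumption
  | |- is_true (0 < _ * _) => apply: mulr_gt0; posit
  | |- is_true (0 < _^-1) => rewrite invr_gt0; posit
  | |- is_true (0 < _ ^+ _) => apply: exprn_gt0; posit
  | |- is_true (0 < expR _) => exact: expR_gt0
  | |- is_true (0 < _%:R) => by rewrite ltr0n
  | |- is_true (0 < _ *+ 2) => rewrite pmulrn_lgt0//; posit
  end.

Section Decay.
Context {R : realType} {A : finType} (r : R) (t : A -> R) (p : A -> R) (al be g : R).

Lemma norm_phase_mean_le1 (F : R -> R) m : probability_vector p ->
  `|phase_mean r t p al F m| <= 1.
Proof.
move=> hp; rewrite /phase_mean (le_trans (ler_norm_sum _ _ _))//.
rewrite -(sum_wprob hp m); apply: ler_sum => w _.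
by rewrite normrM ger0_norm ?wprob_ge0// ler_piMr ?wprob_ge0// cos_max.
Qed.

Lemma level_choice (Lam c : R) n : 0 < Lam -> 0 <= c -> exists m : nat,
  [/\ (0 < m)%N, n%:R * c <= 2 * Lam * m%:R & 2 * Lam * m%:R <= n%:R * c + 2 * Lam].
Proof.
move=> L0 c0; have L2 : 0 < 2 * Lam by lra.
have x0 : 0 <= n%:R * c / (2 * Lam) by rewrite divr_ge0 ?mulr_ge0// ltW.
have /andP[h1 h2] := truncn_itv x0.
exists (Num.truncn (n%:R * c / (2 * Lam))).+1; split=> //.
  by rewrite [leRHS]mulrC -ler_pdivrMr// ltW.
rewrite -[X in _ * X]natr1 mulrDr mulr1 lerD2r.
by rewrite mulrC -ler_pdivlMr.
Qed.

(** With [B = ln b], the level [m] is taken so that [2 Lam m] exceeds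
    [n (B + delta)] by at most [2 Lam], hence [b ^ n * |r| ^ (2 m) <= exp (- n delta)],
    and the linearization errors decay exponentially.  The order [M] of the Fourier
    transform is then at most [C2 / (a ^ n * |r| ^ (3 m))], whose exponential rate
    exceeds [Lam m] by at most [2 n delta] and a constant; by the hypothesis on
    [delta], [2 n delta] is at most a quarter of [m (2 h - Lam)]. *)
Lemma power_phase_decay (l : nat) (rho s a b delta : R) :
  separated_system r t p al be g ->
  (0 < l)%N -> rho != 0 -> 1 < a -> 0 < delta ->
  (forall y, al <= y <= be -> a <= rho * y + s <= b) ->
  let h := entropy p in let Lam := - ln `|r| in
  b <= a * expR delta -> Lam < 2 * h -> 16 * Lam * delta <= ln a * (2 * h - Lam) ->
  exists C : R, forall n j : nat, (j < n)%N -> exists m0 : nat, forall M : nat,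
    (m0 <= M)%N -> `|phase_mean r t p al (power_phase l n j rho s) M| <= C / n%:R.
Proof.
move=> ss l0 rho0 a1 delta0 hab h Lam bdelta Lamh hdelta.
have [hp /andP[r0 r1] albe _ g0 _] := ss.
have hn j n : (j < n)%N -> 0 < n%:R :> R by move=> jn; rewrite ltr0n (leq_ltn_trans _ jn).
have Lam0 : 0 < Lam by rewrite oppr_gt0 ln_lt0// r0.
have rE : `|r| = expR (- Lam) by rewrite /Lam opprK lnK.
have ab : a <= b by have /andP[] := hab al ltac:(by rewrite lexx albe) => h1 h2; apply: le_trans h1 h2.
have a0 : 0 < a by lra.
have b0 : 0 < b by lra.
pose Aa := ln a; pose Bb := ln b.
have aE : a = expR Aa by rewrite lnK.
have bE : b = expR Bb by rewrite lnK.
have A0 : 0 < Aa by rewrite ln_gt0.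
have AB : Aa <= Bb by rewrite ler_ln.
have BA : Bb <= Aa + delta by rewrite -ler_expR -bE expRD -aE.
pose kap := 2 * h - Lam; have kap0 : 0 < kap by rewrite /kap; lra.
pose eta := kap / 8; have eta0 : 0 < eta by rewrite /eta; lra.
pose L : R := pi *+ 2 * l%:R.
have p0 := @pi_gt0 R.
have lR : 0 < l%:R :> R by rewrite ltr0n.
have L0 : 0 < L by rewrite mulr_gt0// pmulrn_lgt0.
pose D := be - al; have D0 : 0 <= D by rewrite subr_ge0.
have arho : 0 < `|rho| by rewrite normr_gt0.
have rho2 : 0 < rho ^+ 2 by rewrite exprn_even_gt0.
pose C1 := L * (2 * rho ^+ 2 * D ^+ 2 + 2 * `|rho| * D + rho ^+ 2 * g * D + 2 * `|rho| * g).
have C10 : 0 < C1.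
  have q1 : 0 <= 2 * rho ^+ 2 * D ^+ 2 by nonneg.
  have q2 : 0 <= 2 * `|rho| * D by nonneg.
  have q3 : 0 <= rho ^+ 2 * g * D by nonneg.
  have q4 : 0 < 2 * `|rho| * g by rewrite !mulr_gt0.
  by rewrite mulr_gt0//; lra.
pose C2 := pi *+ 2 * a ^+ 2 / (L * rho ^+ 2 * g ^+ 2) + D / g + 4.
have C20 : 0 < C2.
  by rewrite ltr_wpDl//; nonneg.
(* For [n >= n0] the frequencies times the mesh of the positions are at most 1; below
   [n0] the trivial bound 1 is at most [n0 / n]. *)
pose n0 := (Num.bound (27 * C1 / delta ^+ 3)).+2.
have n0P n : (n0 <= n)%N -> 27 * C1 / delta ^+ 3 <= n%:R.
  move=> nn; apply: ltW; apply: (@lt_le_trans _ _ (Num.bound (27 * C1 / delta ^+ 3))%:R).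
    by apply: archi_boundP; nonneg.
  by rewrite ler_nat ltnW// ltnW.
pose Ca := 4 * info_variance p * Lam / (eta ^+ 2 * Aa).
pose Cb := 8 * Num.sqrt (C2 * expR (2 * Lam)) * Lam / (kap * Aa).
pose Cc := 27 * C1 / delta ^+ 3.
have V0 : 0 <= info_variance p by apply: info_variance_ge0.
have Ca0 : 0 <= Ca.
  by rewrite /Ca; nonneg.
have Cb0 : 0 <= Cb.
  by rewrite /Cb; nonneg.
have Cc0 : 0 <= Cc by rewrite /Cc; nonneg.
exists (Ca + Cb + Cc + n0%:R) => n j jn.
have nR := hn _ _ jn.
have [nn0|n0n] := ltnP n n0.
  exists 0%N => M _; apply: (le_trans (norm_phase_mean_le1 _ _ hp)).
  rewrite ler_pdivlMr// mul1r.
  have : n%:R <= n0%:R :> R by rewrite ler_nat ltnW.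
  lra.
have n2 : (1 < n)%N by apply: leq_trans n0n.
have B0 : 0 < Bb + delta by clear -A0 AB delta0; lra.
have [m [m0 m1 m2]] := level_choice n Lam0 (ltW B0).
have mR : 0 < m%:R :> R by rewrite ltr0n.
pose Q := `|r| ^+ m.
have QE : Q = expR (- (m%:R * Lam)) by rewrite /Q rE -expRM_natl mulrN.
have anE k : a ^+ k = expR (k%:R * Aa) by rewrite aE -expRM_natl.
have bnE k : b ^+ k = expR (k%:R * Bb) by rewrite bE -expRM_natl.
have Q2E : Q ^+ 2 = expR (- (2 * m%:R * Lam)) by rewrite QE -expRM_natl; congr expR; ring.
have Q3E : Q ^+ 3 = expR (- (3 * m%:R * Lam)) by rewrite QE -expRM_natl; congr expR; ring.
have Q0 : 0 < Q by rewrite QE expR_gt0.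
have Q1 : Q <= 1 by rewrite /Q exprn_ile1// ltW.
have a1' := ltW a1.
have bQ : b ^+ n * Q ^+ 2 <= expR (- (n%:R * delta)).
  by rewrite bnE Q2E -expRD ler_expR; clear -m1; lra.
have ab2 : a ^+ n.-2 <= b ^+ n.
  apply: (@le_trans _ _ (b ^+ n.-2)); first by rewrite lerXn2r// nnegrE ltW.
  by rewrite ler_weXn2l// ?(le_trans a1')// -subn2 leq_subr.
have nb : n%:R ^+ 2 * (b ^+ n * Q ^+ 2) <= 27 / delta ^+ 3 / n%:R.
  apply: (@le_trans _ _ (n%:R ^+ 2 * expR (- (n%:R * delta)))).
    by rewrite ler_wpM2l ?sqr_ge0.
  have nd : 0 < n%:R * delta by rewrite mulr_gt0.
  have c3 := expR_ge_cube (ltW nd).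
  rewrite expRN ler_pdivrMr ?expR_gt0//.
  apply: (@le_trans _ _ (27 / delta ^+ 3 / n%:R * ((n%:R * delta) ^+ 3 / 27))).
    by rewrite le_eqVlt; apply/orP; left; apply/eqP; field; rewrite !gt_eqF.
  by rewrite ler_wpM2l//; nonneg.
have n1R : 1 <= n%:R :> R by rewrite ler1n ltnW.
have n2R : 1 <= n%:R ^+ 2 :> R by rewrite exprn_ege1.
pose K0 := L * rho ^+ 2 * a ^+ n.-2.
pose K1 := L * 2 * `|rho| * (n%:R ^+ 2 * b ^+ n).
pose K2 := L * 2 * rho ^+ 2 * (n%:R ^+ 2 * b ^+ n).
have nbn0 : 0 <= n%:R ^+ 2 * b ^+ n by nonneg.
have K00 : 0 < K0 by rewrite /K0; posit.
have K10 : 0 <= K1 by rewrite /K1; nonneg.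
have K20 : 0 <= K2 by rewrite /K2; nonneg.
have err : Q ^+ 2 * (K2 * D ^+ 2 + K1 * D + K0 * g * D + K1 * g) <= Cc / n%:R.
  apply: (@le_trans _ _ (C1 * (n%:R ^+ 2 * (b ^+ n * Q ^+ 2)))).
    rewrite [leRHS](_ : _ = Q ^+ 2 * (K2 * D ^+ 2 + K1 * D +
       L * rho ^+ 2 * (n%:R ^+ 2 * b ^+ n) * g * D + K1 * g)); last first.
      by rewrite /K1 /K2 /C1; ring.
    rewrite ler_wpM2l ?sqr_ge0// lerD2r lerD2l ler_wpM2r// ler_wpM2r ?(ltW g0)//.
    rewrite ler_wpM2l//; first by nonneg.
    by apply: (le_trans ab2); rewrite ler_peMl//; nonneg.
  rewrite [leRHS](_ : _ = C1 * (27 / delta ^+ 3 / n%:R)).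
    by rewrite ler_wpM2l// ltW.
  by rewrite /Cc; field; rewrite !gt_eqF.
have KQ : K1 * g * Q ^+ 2 <= 1.
  apply: (@le_trans _ _ (Q ^+ 2 * (K2 * D ^+ 2 + K1 * D + K0 * g * D + K1 * g))).
    rewrite mulrC ler_wpM2l ?sqr_ge0// lerDr; nonneg.
  apply: (le_trans err); rewrite ler_pdivrMr// mul1r; exact: n0P.
exists (m + m)%N => M mM.
have -> : M = (m + (m + (M - (m + m))))%N by rewrite addnA subnKC.
have lev := @phase_mean_level R A r t p al be g ss (power_phase l n j rho s)
  (power_phase_deriv l n j rho s) K0 K1 K2 eta m (M - (m + m)) K00 K10 K20 eta0 m0
  (power_phase_taylor l0 jn a1' hab) (power_phase_deriv_le l0 jn a1' hab)
  (fun x y => @power_phase_deriv_growth _ _ _ _ _ _ _ _ _ _ l0 jn a1' hab x y n2) KQ.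
apply: (le_trans lev); rewrite -/D -/Q -/h {lev}.
have mn : Aa * n%:R <= 2 * Lam * m%:R.
  by apply: le_trans m1; rewrite mulrC ler_wpM2l//; clear -AB delta0; lra.
have mV : m%:R^-1 <= 2 * Lam / (Aa * n%:R).
  by rewrite ler_pdivlMr ?mulr_gt0// mulrC ler_pdivrMr.
have T1 : 2 * (info_variance p / (eta ^+ 2 * m%:R)) <= Ca / n%:R.
  rewrite [leLHS](_ : _ = 2 * info_variance p / eta ^+ 2 * m%:R^-1); last first.
    by field; rewrite !gt_eqF.
  apply: (@le_trans _ _ (2 * info_variance p / eta ^+ 2 * (2 * Lam / (Aa * n%:R)))).
    by rewrite ler_wpM2l//; nonneg.
  by rewrite le_eqVlt; apply/orP; left; apply/eqP; rewrite /Ca; field; rewrite !gt_eqF.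
(* The typical words.  The exponent below is [- m (2 h - Lam) / 2 + 2 Lam]: of the
   available [- m (2 h - Lam)], a quarter pays for [eta] and a quarter for [delta]. *)
have T2 : expR (- (m%:R * (h - eta))) *
   Num.sqrt (pi *+ 2 / (K0 * g ^+ 2 * Q ^+ 3) + D / (g * Q) + 4) <= Cb / n%:R.
  set X := _ + 4.
  have anQ3 : 0 < a ^+ n * Q ^+ 3 by posit.
  have anQ1 : a ^+ n * Q ^+ 2 <= 1.
    apply: (@le_trans _ _ (b ^+ n * Q ^+ 2)).
      by rewrite ler_wpM2r ?sqr_ge0// lerXn2r// nnegrE ltW.
    by apply: (le_trans bQ); rewrite -expR0 ler_expR oppr_le0; nonneg.
  have XC : X <= C2 / (a ^+ n * Q ^+ 3).
    rewrite ler_pdivlMr// /X /C2 [leLHS]mulrDl [X in X + _ <= _]mulrDl.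
    apply: lerD; first apply: lerD.
    - rewrite /K0 (_ : a ^+ n = a ^+ n.-2 * a ^+ 2); last by rewrite -exprD -subn2 subnK.
      rewrite le_eqVlt; apply/orP; left; apply/eqP; field.
      by rewrite rho0 !gt_eqF//; posit.
    - rewrite [leLHS](_ : _ = D / g * (a ^+ n * Q ^+ 2)); last by field; rewrite !gt_eqF.
      by rewrite ler_piMr//; nonneg.
    - rewrite ler_piMr// (exprS Q 2) mulrCA mulr_ile1//; nonneg.
  have X0 : 0 <= X.
    by rewrite /X; nonneg.
  have -> : expR (- (m%:R * (h - eta))) = Num.sqrt (expR (- (2 * m%:R * (h - eta)))).
    have -> : - (2 * m%:R * (h - eta)) = 2%:R * (- (m%:R * (h - eta))) by ring.
    by rewrite expRM_natl sqrtr_sqr ger0_norm ?expR_ge0.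
  rewrite -sqrtrM ?expR_ge0//.
  have bound : expR (- (2 * m%:R * (h - eta))) * X <=
      C2 * expR (2 * Lam) * (4 / (m%:R * kap)) ^+ 2.
    apply: (@le_trans _ _ (C2 * (expR (- (2 * m%:R * (h - eta))) / (a ^+ n * Q ^+ 3)))).
      by rewrite mulrCA ler_wpM2l ?expR_ge0.
    rewrite -!mulrA ler_wpM2l ?(ltW C20)//.
    rewrite anE Q3E -expRD -expRN -expRD.
    apply: (@le_trans _ _ (expR (2 * Lam) * expR (- (m%:R * kap / 2)))).
      rewrite -expRD ler_expR.
      have nd : 16 * Lam * (n%:R * delta) <= 2 * Lam * m%:R * kap.
        apply: (@le_trans _ _ (Aa * n%:R * kap)); last by rewrite ler_wpM2r// ltW.
        have := ler_wpM2l (ltW nR) hdelta; rewrite -/Aa -/kap; clear; lra.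
      have nd' : 8 * (n%:R * delta) <= m%:R * kap.
        by rewrite -(@ler_pM2l _ (2 * Lam)) ?mulr_gt0//; clear -nd; lra.
      have BAn : n%:R * Bb <= n%:R * Aa + n%:R * delta by rewrite -mulrDr ler_wpM2l// ltW.
      clear -nd' BAn m2 Lam0 mR; rewrite /eta; rewrite /kap in nd' *; lra.
    rewrite ler_wpM2l ?expR_ge0//.
    have mk : 0 < m%:R * kap / 2 by posit.
    have sq := expR_ge_sqr (ltW mk).
    rewrite expRN -[leRHS]invrK lef_pV2 ?posrE ?expR_gt0//; last first.
      by posit.
    apply: le_trans sq; rewrite le_eqVlt; apply/orP; left; apply/eqP.
    by field; rewrite !gt_eqF.
  apply: (le_trans (ler_wsqrtr bound)).
  have mk4 : 0 <= 4 / (m%:R * kap) by nonneg.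
  rewrite sqrtrM; last by nonneg.
  rewrite sqrtr_sqr ger0_norm//.
  set Sq := Num.sqrt _.
  have Sq0 : 0 <= Sq by apply: sqrtr_ge0.
  rewrite [leLHS](_ : _ = 4 * Sq / kap * m%:R^-1); last by field; rewrite !gt_eqF.
  apply: (@le_trans _ _ (4 * Sq / kap * (2 * Lam / (Aa * n%:R)))).
    by rewrite ler_wpM2l//; nonneg.
  by rewrite le_eqVlt; apply/orP; left; apply/eqP; rewrite /Cb -/Sq; field; rewrite !gt_eqF.
have -> : (Ca + Cb + Cc + n0%:R) / n%:R =
    Ca / n%:R + Cb / n%:R + Cc / n%:R + n0%:R / n%:R by rewrite -!mulrDl.
have n0n' : 0 <= n0%:R / n%:R :> R by nonneg.
apply: (le_trans _ (_ : Ca / n%:R + Cb / n%:R + Cc / n%:R <= _)); last by rewrite lerDl.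
by apply: lerD => //; apply: lerD.
Qed.

End Decay.

(** * Second moments of the Weyl sums *)

Lemma sqrt_nat (N : nat) : exists k : nat, (k ^ 2 <= N < k.+1 ^ 2)%N.
Proof.
elim: N => [|N [k /andP[k1 k2]]]; first by exists 0%N.
have [h|h] := ltnP N.+1 (k.+1 ^ 2)%N; first by exists k; rewrite h (leq_trans k1).
exists k.+1; rewrite h/= (leq_ltn_trans k2)//.
by rewrite ltn_sqr.
Qed.

Section SecondMoment.
Context {R : realType}.

(** If [k ^ 2 <= N < (k + 1) ^ 2], the sums up to [N] and up to [k ^ 2] differ by at
    most [2 k], which is negligible compared with [N]. *)
Lemma cesaro_cvg0_of_squares (c : nat -> R) : (forall n, `|c n| <= 1) ->
  (forall e : R, 0 < e -> exists k0 : nat, forall k, (k0 <= k)%N ->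
     (\sum_(1 <= n < (k ^ 2).+1) c n) ^+ 2 <= e * k%:R ^+ 4) ->
  cesaro c @ \oo --> (0 : R).
Proof.
move=> c1 hsq; apply/cvgrPdist_le => e e0.
have e2 : 0 < (e / 2) ^+ 2 by rewrite exprn_gt0//; lra.
have [k0 hk0] := hsq _ e2.
pose K := maxn k0 (Num.bound (4 / e)).+1.
exists (K ^ 2)%N => //= N KN.
have [k /andP[kN Nk]] := sqrt_nat N.
have Kk : (K <= k)%N by rewrite -ltnS -ltn_sqr (leq_ltn_trans KN).
have k0k : (k0 <= k)%N by rewrite (leq_trans _ Kk)// leq_maxl.
have kb : ((Num.bound (4 / e)).+1 <= k)%N by rewrite (leq_trans _ Kk)// leq_maxr.
have k_gt0 : (0 < k)%N by apply: leq_trans kb.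
have kR : 0 < k%:R :> R by rewrite ltr0n.
have ke : 4 / e <= k%:R.
  apply: ltW; apply: (@lt_le_trans _ _ (Num.bound (4 / e))%:R).
    by apply: archi_boundP; rewrite divr_ge0// ltW.
  by rewrite ler_nat ltnW.
have NR : 0 < N%:R :> R by rewrite ltr0n (leq_trans _ kN)// expn_gt0 k_gt0.
have kNR : k%:R ^+ 2 <= N%:R :> R by rewrite -natrX ler_nat.
have S1 : `|\sum_(1 <= n < (k ^ 2).+1) c n| <= e / 2 * k%:R ^+ 2.
  rewrite -(@ler_pXn2r _ 2)// ?nnegrE//; last by rewrite mulr_ge0 ?sqr_ge0//; lra.
  by rewrite real_normK ?num_real// exprMn -exprM; apply: hk0.
have S2 : `|\sum_((k ^ 2).+1 <= n < N.+1) c n| <= 2 * k%:R.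
  apply: (le_trans (ler_norm_sum _ _ _)).
  apply: (@le_trans _ _ (\sum_((k ^ 2).+1 <= n < N.+1) 1)); first exact: ler_sum.
  rewrite sumr_const_nat subSS -natrM ler_nat; move: Nk; rewrite !expnS !expn0; lia.
rewrite distrC subr0 /cesaro normrM [X in _ * X]gtr0_norm ?invr_gt0// ler_pdivrMr//.
rewrite (@big_cat_nat _ _ _ (k ^ 2).+1)//=; apply: (le_trans (ler_normD _ _)).
apply: (le_trans (lerD S1 S2)).
apply: (@le_trans _ _ (e * k%:R ^+ 2)); last by rewrite ler_wpM2l// ltW.
move: ke; rewrite ler_pdivrMr//; nra.
Qed.

Lemma lipschitz_sum (I : finType) (D : set R) (f : I -> R -> R) :
  (forall i, exists2 K, 0 <= K & forall x y, D x -> D y -> `|f i x - f i y| <= K * `|x - y|) ->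
  exists2 K, 0 <= K & forall x y, D x -> D y ->
    `|\sum_i f i x - \sum_i f i y| <= K * `|x - y|.
Proof.
move=> h; pose K i := sval (cid2 (h i)).
have [K0 hK] : (forall i, 0 <= K i) /\
    forall i x y, D x -> D y -> `|f i x - f i y| <= K i * `|x - y|.
  by split=> i; rewrite /K; case: cid2.
exists (\sum_i K i) => [|x y Dx Dy]; first exact: sumr_ge0.
rewrite -sumrB mulr_suml; apply: (le_trans (ler_norm_sum _ _ _)).
by apply: ler_sum => i _; apply: hK.
Qed.

(** The squared modulus of the exponential sum of the frequencies [l * x ^ n]
    with [1 <= n <= N], evaluated at [x = rho * y + s]. *)
Definition weyl_sqr (l N : nat) (rho s y : R) : R :=
  \sum_(i < N) \sum_(j < N) cos (power_phase l i.+1 j.+1 rho s y).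

Lemma weyl_sqrE l N rho s y : weyl_sqr l N rho s y =
  (\sum_(1 <= n < N.+1) cos (l%:R * (pi *+ 2 * (rho * y + s) ^+ n))) ^+ 2 +
  (\sum_(1 <= n < N.+1) sin (l%:R * (pi *+ 2 * (rho * y + s) ^+ n))) ^+ 2.
Proof.
rewrite !big_add1 !big_mkord.
have := @sqr_sum_cos_sin R _ (fun=> 1) (fun i : 'I_N => l%:R * (pi *+ 2 * (rho * y + s) ^+ i.+1)).
rewrite (eq_bigr _ (fun i _ => mul1r _)) (eq_bigr _ (fun i _ => mul1r _)) => ->.
apply: eq_bigr => i _; apply: eq_bigr => j _; rewrite !mul1r; congr cos.
by rewrite /power_phase; ring.
Qed.

Lemma weyl_sqr_ge0 l N rho s y : 0 <= weyl_sqr l N rho s y.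
Proof. by rewrite weyl_sqrE addr_ge0 ?sqr_ge0. Qed.

Lemma weyl_sqr_lipschitz l N rho s b al be : 1 <= b ->
  (forall y, al <= y <= be -> `|rho * y + s| <= b) ->
  exists2 K, 0 <= K & forall x y, al <= x <= be -> al <= y <= be ->
    `|weyl_sqr l N rho s x - weyl_sqr l N rho s y| <= K * `|x - y|.
Proof.
move=> b1 hb; have b0 : 0 <= b by lra.
apply: (@lipschitz_sum _ [set x | al <= x <= be]) => i.
apply: (@lipschitz_sum _ [set x | al <= x <= be]) => j.
have L0 : 0 <= pi *+ 2 * l%:R :> R by rewrite mulr_ge0// mulrn_wge0 ?pi_ge0.
exists (pi *+ 2 * l%:R * ((i.+1%:R * b ^+ i.+1 + j.+1%:R * b ^+ j.+1) * `|rho|)).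
  by rewrite mulr_ge0// mulr_ge0// addr_ge0// mulr_ge0// exprn_ge0.
move=> x y /= /hb xb /hb yb; apply: (le_trans (dist_cos _ _)).
rewrite /power_phase; set X := rho * x + s in xb *; set Y := rho * y + s in yb *.
have XY : X - Y = rho * (x - y) by rewrite /X /Y; ring.
move: L0; set L := pi *+ 2 * l%:R => L0.
rewrite -mulrBr normrM ger0_norm// -[leRHS]mulrA ler_wpM2l// -[leRHS]mulrA -normrM -XY.
rewrite (_ : X ^+ i.+1 - X ^+ j.+1 - (Y ^+ i.+1 - Y ^+ j.+1) =
   (X ^+ i.+1 - Y ^+ i.+1) - (X ^+ j.+1 - Y ^+ j.+1)); last by ring.
apply: (le_trans (ler_normB _ _)); rewrite mulrDl.
by apply: lerD; apply: dist_expr_le.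
Qed.

Lemma power_phaseC l n j (rho s y : R) : cos (power_phase l n j rho s y) = cos (power_phase l j n rho s y).
Proof. by rewrite -cosN; congr cos; rewrite /power_phase; ring. Qed.

(** The diagonal contributes [N].  The terms with [j < i] contribute at most
    [C / (i + 1)], so at most [C] for each [i], and those with [i < j] are equal to them by
    symmetry. *)
Lemma weyl_sqr_mean_le (A : finType) (r : R) (t p : A -> R) (al C : R) l rho s :
  probability_vector p ->
  (forall n j : nat, (j < n)%N -> exists m0 : nat, forall M : nat,
    (m0 <= M)%N -> `|phase_mean r t p al (power_phase l n j rho s) M| <= C / n%:R) ->
  forall N, exists m0 : nat, forall M : nat, (m0 <= M)%N ->
    \sum_(w : word A M) wprob p w * weyl_sqr l N rho s (wmap r t w al) <= (1 + 2 * C) * N%:R.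
Proof.
move=> hp hC N.
have C0 : 0 <= C.
  have [m /(_ m (leqnn _))] := hC 1%N 0%N isT; rewrite divr1; exact: le_trans.
pose f (i j : nat) : nat := if pselect (j < i)%N is left ji then sval (cid (hC i j ji)) else 0%N.
have hf i j M : (j < i)%N -> (f i j <= M)%N ->
    `|phase_mean r t p al (power_phase l i j rho s) M| <= C / i%:R.
  by move=> ji; rewrite /f; case: pselect => // ji'; case: cid => //= m hm; apply: hm.
exists (\sum_(i < N) \sum_(j < N) f i.+1 j.+1)%N => M hM.
have fM (i j : 'I_N) : (f i.+1 j.+1 <= M)%N.
  apply: leq_trans hM; rewrite (bigD1 i)//= (bigD1 j)//= -addnA; exact: leq_addr.
rewrite [leLHS](_ : _ = \sum_(i < N) \sum_(j < N)
    phase_mean r t p al (power_phase l i.+1 j.+1 rho s) M); last first.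
  under eq_bigr do rewrite mulr_sumr.
  rewrite exchange_big/=; apply: eq_bigr => i _.
  under eq_bigr do rewrite mulr_sumr.
  by rewrite exchange_big/=; apply: eq_bigr => j _.
pose E (i j : 'I_N) : R := (j < i)%N%:R * (C / i.+1%:R).
have hE (i : 'I_N) : \sum_(j < N) E i j <= C.
  rewrite -mulr_suml -natr_sum (_ : (\sum_(j < N) (j < i) = i)%N).
    by rewrite mulrCA ler_piMr// ler_pdivrMr// mul1r ler_nat.
  rewrite (eq_bigr (fun j : 'I_N => if (j < i)%N then 1%N else 0%N)); last by move=> j _; case: ltnP.
  by rewrite -big_mkcond/= -(big_ord_widen N (fun=> 1%N)) ?sum1_card ?card_ord// ltnW.
have term_le (i j : 'I_N) : phase_mean r t p al (power_phase l i.+1 j.+1 rho s) M <=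
    (i == j)%:R + (E i j + E j i).
  rewrite -val_eqE/= /E; case: (ltngtP i j) => [h|h|h].
  - rewrite mul0r !add0r mul1r; have := hf j.+1 i.+1 M h (fM j i).
    rewrite (_ : phase_mean _ _ _ _ (power_phase l j.+1 i.+1 rho s) M =
       phase_mean r t p al (power_phase l i.+1 j.+1 rho s) M); last first.
      by apply: eq_bigr => w _; rewrite power_phaseC.
    exact/le_trans/ler_norm.
  - rewrite mul0r add0r addr0 mul1r; have := hf i.+1 j.+1 M h (fM i j).
    exact/le_trans/ler_norm.
  - rewrite !mul0r !addr0; apply: (le_trans (ler_norm _)); exact: norm_phase_mean_le1.
apply: (@le_trans _ _ (\sum_(i < N) \sum_(j < N) ((i == j)%:R + (E i j + E j i)))).
  by apply: ler_sum => i _; apply: ler_sum.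
under eq_bigr do rewrite !big_split/=.
rewrite !big_split/= [X in _ + (_ + X)]exchange_big/=.
have hS : \sum_(i < N) \sum_(j < N) E i j <= C * N%:R.
  apply: (@le_trans _ _ (\sum_(i < N) C)); first by apply: ler_sum => i _; apply: hE.
  by rewrite sumr_const card_ord mulr_natr.
have hD : \sum_(i < N) \sum_(j < N) (i == j)%:R = N%:R :> R.
  rewrite (eq_bigr (fun=> 1)) ?sumr_const ?card_ord// => i _.
  by rewrite (bigD1 i)//= eqxx big1 ?addr0// => j /negbTE; rewrite eq_sym => ->.
rewrite hD; lra.
Qed.
End SecondMoment.

(** * Self-similar measures on cylinders *)

Section SelfSimilarMeasure.
Context {R : realType} {A : finType} (r : R) (t : A -> R) (p : A -> R) (al be g : R).
Context (mu : probability (measurableTypeR R) R).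
Context (ss : separated_system r t p al be g).
Context (hmu : self_similar_measure (fun i => similarity r (t i)) p mu).

Local Notation T := (measurableTypeR R).
(** [mu] with real values, on which field operations and real sums are available. *)
Definition pr (B : set T) : R := fine (mu B).

Lemma measurable_affine (a b : R) (B : set T) : measurable B ->
  measurable ((fun x : T => a * x + b : T) @^-1` B).
Proof.
move=> mB; rewrite -[X in measurable X]setTI.
have : measurable_fun setT (fun x : T => a * x + b : T).
  by apply: measurable_funD => //; apply: measurable_funM.
by apply.
Qed.

Lemma measurable_wmap m (w : word A m) (B : set T) : measurable B ->
  measurable ((wmap r t w : T -> T) @^-1` B).
Proof.
move=> mB; rewrite (_ : (wmap r t w : T -> T) = (fun x => r ^+ m * x + wmap r t w 0)).
  exact: measurable_affine.
by apply/funext => x; exact: wmap_affine.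
Qed.

Lemma prE (B : set T) : measurable B -> mu B = (pr B)%:E.
Proof. by move=> mB; rewrite /pr fineK// fin_num_measure. Qed.

Lemma pr_ge0 B : 0 <= pr B.
Proof. exact: fine_ge0. Qed.

Lemma pr_le1 B : measurable B -> pr B <= 1.
Proof. by move=> mB; rewrite -lee_fin -prE// probability_le1. Qed.

Lemma le_pr B C : measurable B -> measurable C -> B `<=` C -> pr B <= pr C.
Proof. by move=> mB mC BC; rewrite -lee_fin -!prE// le_measure ?inE. Qed.

Lemma pr_words m B : measurable B ->
  pr B = \sum_(w : word A m) wprob p w * pr ((wmap r t w : T -> T) @^-1` B).
Proof.
elim: m B => [|m IH] B mB; first by rewrite sum_word0/= mul1r.
have mBi i : measurable ((similarity r (t i) : T -> T) @^-1` B) by apply: measurable_affine.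
have E : pr B = \sum_(i : A) p i * pr ((similarity r (t i) : T -> T) @^-1` B).
  apply: EFin_inj; rewrite -prE// hmu// -sumEFin; apply: eq_bigr => i _.
  by rewrite EFinM -prE.
rewrite E sum_wordS; apply: eq_bigr => i _.
rewrite (IH _ (mBi i)) mulr_sumr; apply: eq_bigr => w _.
by rewrite /= mulrA.
Qed.

Let I : set T := [set x | al <= x <= be].

Lemma measurable_seg (a b : R) : measurable ([set x | a <= x <= b] : set T).
Proof.
rewrite (_ : [set x | _] = [set` `[a, b]]); last by apply/seteqP; split => x /=; rewrite in_itv.
exact: measurable_itv.
Qed.

(** The preimage of the [q]-neighbourhood of [I] under each contraction contains the
    [q / |r|]-neighbourhood, so by self-similarity the measure does not decrease when
    [q] does; as [q] grows it tends to 1. *)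
Lemma pr_nbhd_seg (q : R) : 0 < q -> pr [set x | al - q <= x <= be + q] = 1.
Proof.
move=> q0; have [hp /andP[r0 r1] albe st _ _] := ss.
pose J (q : R) : set T := [set x | al - q <= x <= be + q].
have mJ q' : measurable (J q') by apply: measurable_seg.
have step q' : 0 < q' -> pr (J (q' / `|r|)) <= pr (J q').
  move=> q'0; rewrite (@pr_words 1 (J q')) // sum_wordS.
  under eq_bigr do rewrite sum_word0/= mulr1.
  rewrite -[leLHS]mul1r; case: hp => p0 <-; rewrite mulr_suml; apply: ler_sum => i _.
  rewrite ler_wpM2l//; apply: le_pr => //; first exact: measurable_affine.
  move=> x /= /andP[x1 x2].
  have : exists2 y, al <= y <= be & `|x - y| <= q' / `|r|.
    have [xal|alx] := ltP x al; first by exists al; rewrite ?lexx// ler0_norm; lra.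
    have [bex|xbe] := ltP be x; first by exists be; rewrite ?lexx ?andbT// ger0_norm; lra.
    by exists x; rewrite ?alx// subrr normr0 divr_ge0// ltW.
  case=> y /(st i) yI xy.
  have : `|similarity r (t i) x - similarity r (t i) y| <= q'.
    rewrite [X in `|X|](_ : _ = r * (x - y)); last by rewrite /similarity; ring.
    by rewrite normrM mulrC -ler_pdivlMr.
  rewrite ler_norml => /andP[h1 h2]; rewrite /J/=.
  by move: yI h1 h2 => /andP[]; set u := similarity _ _ x; set v := similarity _ _ y; lra.
have steps k : pr (J (q / `|r| ^+ k)) <= pr (J q).
  elim: k => [|k IH]; first by rewrite expr0 divr1.
  apply: le_trans IH; rewrite exprSr invfM mulrA; apply: step.
  by rewrite divr_gt0// exprn_gt0.
have cvgJ : mu (J (q / `|r| ^+ k)) @[k --> \oo] --> mu (\bigcup_k (J (q / `|r| ^+ k))).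
  apply: nondecreasing_cvg_mu => //; first exact: bigcupT_measurable.
  apply/nondecreasing_seqP => k; apply/subsetPset => x /= /andP[x1 x2].
  have : q / `|r| ^+ k <= q / `|r| ^+ k.+1.
    rewrite ler_pM2l// lef_pV2 ?posrE ?exprn_gt0// exprS.
    by rewrite ler_piMl ?exprn_ge0// ltW.
  by rewrite /J/=; lra.
have JT : \bigcup_k (J (q / `|r| ^+ k)) = setT.
  apply/seteqP; split => // x _.
  pose X := `|x| + `|al| + `|be| + 1.
  have X0 : 0 < X by rewrite ltr_wpDl// !addr_ge0.
  have r1' : `| `|r| | < 1 by rewrite normr_id.
  have /cvgrPdist_le/(_ (q / X)) := cvg_expr r1'.
  move=> /(_ (divr_gt0 q0 X0))[k _ /(_ k (leqnn k))].
  rewrite sub0r normrN ger0_norm ?exprn_ge0// => rk.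
  exists k => //; rewrite /J/=.
  have : X <= q / `|r| ^+ k by rewrite ler_pdivlMr ?exprn_gt0// mulrC -ler_pdivlMr.
  rewrite /X; have := ler_norm x; have := ler_norm (- x); have := ler_norm al.
  have := ler_norm (- be); rewrite !normrN; have := normr_ge0 al; have := normr_ge0 be.
  by move=> *; apply/andP; split; lra.
apply/eqP; rewrite eq_le (pr_le1 (mJ q))/=.
rewrite -lee_fin -(prE (mJ q)); rewrite JT probability_setT in cvgJ.
rewrite -(cvg_lim (@ereal_hausdorff R) cvgJ); apply: lime_le; first by apply/cvg_ex; eexists; exact: cvgJ.
by apply: nearW => k; rewrite (prE (mJ _)) (prE (mJ q)) lee_fin; exact: steps.
Qed.

Lemma negligible_out_seg : mu.-negligible (~` I).
Proof.
pose J (n : nat) : set T := [set x | al - n.+1%:R^-1 <= x <= be + n.+1%:R^-1].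
rewrite (_ : ~` I = \bigcup_n (~` J n)).
  apply: negligible_bigcup => n; apply/negligibleP.
    by apply: measurableC; apply: measurable_seg.
  have mJ : measurable (J n) by apply: measurable_seg.
  have := @probability_setC _ _ _ mu _ mJ.
  by rewrite (prE mJ) pr_nbhd_seg ?invr_gt0// subee.
apply/seteqP; split => x /=; last first.
  move=> [n _] /= nJ; apply: contra_not nJ; rewrite /I /J /= => /andP[x1 x2].
  have : 0 < n.+1%:R^-1 :> R by rewrite invr_gt0.
  by move: (n.+1%:R^-1 : R) => u u0; apply/andP; split; lra.
rewrite /I/= => /negP; rewrite negb_and -!ltNge => xI.
pose d := Num.max (al - x) (x - be).
have d0 : 0 < d by rewrite lt_max !subr_gt0.
have [n _ /(_ n (leqnn n)) /= nd] := near_infty_natSinv_lt (PosNum d0).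
exists n => //; rewrite /J /= => /andP[x1 x2].
move: x1 x2 nd; move: (n.+1%:R^-1 : R) => u x1 x2; rewrite /d lt_max => /orP[]; lra.
Qed.

Lemma pr_disjoint_seg B : measurable B -> (forall x, al <= x <= be -> ~ B x) -> pr B = 0.
Proof.
move=> mB BI; rewrite /pr (_ : mu B = 0%E)//.
apply/negligibleP => //; apply: negligibleS negligible_out_seg => x Bx /= xI.
exact: BI Bx.
Qed.

(** A cylinder of level [m] meets [[set x | c <= F x]] only if [F] is at least [c - e]
    at its base point, so Markov's inequality for the discrete average applies. *)
Lemma pr_markov (F : R -> R) (c e : R) m : 0 < c - e ->
  measurable ([set x | c <= F x] : set T) -> (forall x, 0 <= F x) ->
  (forall (w : word A m) x, al <= x <= be -> F (wmap r t w x) <= F (wmap r t w al) + e) ->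
  pr [set x | c <= F x] <= (\sum_(w : word A m) wprob p w * F (wmap r t w al)) / (c - e).
Proof.
move=> ce mB F0 osc; have [hp _ _ _ _ _] := ss.
rewrite (pr_words m mB) mulr_suml; apply: ler_sum => w _.
rewrite -mulrA ler_wpM2l ?wprob_ge0// ler_pdivlMr//.
have [h|h] := leP (c - e) (F (wmap r t w al)).
  by apply: le_trans h; rewrite ler_piMl ?(ltW ce)// pr_le1//; apply: measurable_wmap.
rewrite pr_disjoint_seg ?mul0r//; first exact: measurable_wmap.
by move=> x /(osc w) /= h1 h2; lra.
Qed.

(** The series of [1 / (k + 1) ^ 2] is dominated by a telescoping one. *)
Lemma borel_cantelli_sqr (B : nat -> set T) (C : R) : (forall k, measurable (B k)) ->
  (forall k, pr (B k) <= C / k.+1%:R ^+ 2) -> mu.-negligible (lim_sup_set B).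
Proof.
move=> mB hB.
have mL : measurable (lim_sup_set B).
  by apply: bigcapT_measurable => n; apply: bigcup_measurable.
apply/negligibleP => //; apply: lim_sup_set_cvg0 => //.
have C0 : 0 <= C by have := le_trans (pr_ge0 (B 0%N)) (hB 0%N); rewrite expr1n divr1.
apply: (@le_lt_trans _ _ ((2 * C)%:E)); last exact: ltry.
apply: lime_le; first exact: is_cvg_ereal_nneg_natsum.
apply: nearW => n.
have sum_le m : \sum_(0 <= k < m.+1) pr (B k) <= 2 * C - C / m.+1%:R.
  elim: m => [|m IH]; first by rewrite big_nat1 (le_trans (hB 0%N))// expr1n divr1; lra.
  rewrite big_nat_recr//=; apply: (le_trans (lerD IH (hB m.+1))).
  have m0 : 0 < m.+1%:R :> R by rewrite ltr0n.
  have m1 : 0 < m.+2%:R :> R by rewrite ltr0n.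
  have E : m.+2%:R = m.+1%:R + 1 :> R by rewrite natr1.
  rewrite -subr_ge0.
  have -> : 2 * C - C / m.+2%:R - (2 * C - C / m.+1%:R + C / m.+2%:R ^+ 2) =
      C / (m.+1%:R * m.+2%:R ^+ 2).
    rewrite E in m1 *; move: m0 m1; set x := m.+1%:R => m0 m1.
    by field; rewrite !gt_eqF.
  by rewrite divr_ge0// mulr_ge0// ?exprn_ge0 ltW.
rewrite (eq_bigr (fun k => (pr (B k))%:E)); last by move=> k _; exact: prE.
rewrite sumEFin lee_fin; apply: (@le_trans _ _ (\sum_(0 <= k < n.+1) pr (B k))).
  by rewrite big_nat_recr//= lerDl pr_ge0.
by rewrite (le_trans (sum_le n))// gerBl divr_ge0.
Qed.

End SelfSimilarMeasure.

(** * Almost sure bounds *)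

Section AlmostEverywhere.
Context {R : realType} {A : finType} (r : R) (t : A -> R) (p : A -> R) (al be g : R).
Context (mu : probability (measurableTypeR R) R).
Context (ss : separated_system r t p al be g).
Context (hmu : self_similar_measure (fun i => similarity r (t i)) p mu).

Local Notation T := (measurableTypeR R).
Local Notation pr := (pr mu).

(** By separation a point lies in at most one cylinder of level [m], and the
    probability of a cylinder is [O (1 / m)]: it is either atypical, and Chebyshev's
    inequality applies, or exponentially small. *)
Lemma pr_point (z : R) : 0 < entropy p -> pr [set z] = 0.
Proof.
move=> h0; have [hp /andP[r0 r1] albe _ g0 _] := ss.
pose eta := entropy p / 2; have eta0 : 0 < eta by rewrite /eta; lra.
have V0 : 0 <= info_variance p by apply: info_variance_ge0.
pose C := info_variance p / eta ^+ 2 + eta^-1.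
have m1z : measurable ([set z] : set T) by exact: measurable_set1.
have prob_le m (w : word A m) : (0 < m)%N -> wprob p w <= C / m%:R.
  move=> m0; have mR : 0 < m%:R :> R by rewrite ltr0n.
  have [h|h] := ltP (winfo p w) (m%:R * (entropy p - eta)).
    apply: (@le_trans _ _ (info_variance p / (eta ^+ 2 * m%:R))).
      apply: le_trans (atypical_mass hp m0 eta0).
      rewrite (bigD1 w)//= lerDl sumr_ge0// => w' _; exact: wprob_ge0.
    rewrite /C mulrDl invfM mulrA lerDl mulr_ge0// invr_ge0; exact: ltW.
  apply: (le_trans (wprob_le_expR hp w)).
  have le1 : expR (- winfo p w) <= expR (- (m%:R * eta)).
    rewrite ler_expR lerN2; apply: le_trans h; rewrite /eta; lra.
  apply: (le_trans le1); rewrite expRN.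
  have x0 : 0 < m%:R * eta by rewrite mulr_gt0.
  have ex : m%:R * eta <= expR (m%:R * eta).
    by apply: le_trans (expR_ge1Dx _); rewrite lerDr.
  apply: (@le_trans _ _ (m%:R * eta)^-1); first by rewrite lef_pV2 ?posrE// expR_gt0.
  rewrite /C mulrDl [X in X <= _](_ : _ = eta^-1 / m%:R); last by rewrite invfM mulrC.
  by rewrite lerDr divr_ge0// ?divr_ge0 ?sqr_ge0// ltW.
have le_all m : (0 < m)%N -> pr [set z] <= C / m%:R.
  move=> m0; rewrite (pr_words hmu m m1z).
  have mw (w : word A m) : measurable ((wmap r t w : T -> T) @^-1` [set z]).
    exact: measurable_wmap.
  have [[w0 [x0 x0I w0z]]|none] := pselect (exists w : word A m, exists2 x, al <= x <= be & wmap r t w x = z); last first.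
    rewrite big1 ?divr_ge0//.
      by rewrite /C addr_ge0// ?divr_ge0 ?sqr_ge0// invr_ge0 ltW.
    move=> w _; rewrite (pr_disjoint_seg ss hmu (mw w)) ?mulr0// => x xI wxz.
    by apply: none; exists w => //; exists x.
  rewrite (bigD1 w0)//= [X in _ + X]big1 ?addr0.
    apply: le_trans (prob_le m w0 m0); rewrite ler_piMr ?pr_le1//; exact: wprob_ge0.
  move=> w ww0; rewrite (pr_disjoint_seg ss hmu (mw w)) ?mulr0// => x xI wxz.
  have := wmap_sep ss ww0 xI x0I; rewrite wxz w0z subrr normr0 leNgt => /negP; apply.
  by rewrite mulr_gt0// exprn_gt0.
apply/eqP; rewrite eq_le pr_ge0 andbT leNgt; apply/negP => q0.
pose m := (Num.bound (C / pr [set z])).+1.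
have C0 : 0 <= C by rewrite /C addr_ge0// ?divr_ge0 ?sqr_ge0// invr_ge0 ltW.
have := le_all m isT; rewrite leNgt => /negP; apply.
rewrite ltr_pdivrMr ?ltr0n// mulrC -ltr_pdivrMr//.
apply: (@lt_le_trans _ _ (Num.bound (C / pr [set z]))%:R).
  by apply: archi_boundP; rewrite divr_ge0// ltW.
by rewrite ler_nat.
Qed.

(** A null set that works for [P] is the intersection over [w] of the images under
    [phi_w] of the null sets [N w]: an exceptional point is exceptional as seen from
    every [w], and the preimage of the intersection under [phi_w] lies in [N w]. *)
Lemma ae_words m (P : R -> Prop) :
  (forall w : word A m, {ae mu, forall y, P (wmap r t w y)}) -> {ae mu, forall x, P x}.
Proof.
move=> h; have [hp /andP[r0 r1] _ _ _ _] := ss.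
have rm0 : r ^+ m != 0 by rewrite expf_neq0// -normr_gt0.
have {}h (w : word A m) : exists N : set T,
  [/\ measurable N, mu N = 0%E & forall y, ~ P (wmap r t w y) -> N y].
  by have [N [mN N0 PN]] := h w; exists N; split=> // y nP; apply: PN.
have [N hN] := choice h.
pose psi (w : word A m) (x : T) : T := (r ^+ m)^-1 * x + - ((r ^+ m)^-1 * wmap r t w 0).
have psiK w x : wmap r t w (psi w x) = x.
  rewrite wmap_affine /similarity /psi; by field.
have wmapK w y : psi w (wmap r t w y) = y.
  rewrite wmap_affine /similarity /psi; by field.
pose S : set T := \bigcap_(w in [set: word A m]) (psi w @^-1` N w).
have mS : measurable S.
  apply: fin_bigcap_measurable => [|w _]; first exact: finite_finset.
  by apply: measurable_affine; have [] := hN w.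
exists S; split=> //.
  have : pr S = 0.
    rewrite (pr_words hmu m mS) big1// => w _.
    have [mN N0 _] := hN w.
    apply/eqP; rewrite mulf_eq0; apply/orP; right.
    rewrite eq_le pr_ge0 andbT (_ : 0 = pr (N w)); last by move: (prE mu mN); rewrite N0 => -[].
    apply: le_pr => //; first exact: measurable_wmap.
    by move=> y /= /(_ w I); rewrite /= wmapK.
  by move=> E; rewrite prE// E.
move=> x /= nP w _ /=; have [_ _ hNw] := hN w.
by apply: hNw; rewrite psiK.
Qed.

Lemma measurable_weyl_sqr l N (rho s c : R) :
  measurable ([set y | c <= weyl_sqr l N rho s y] : set T).
Proof.
have mphase n j : measurable_fun setT (power_phase l n j rho s : T -> T).
  have mG : measurable_fun setT (fun y : T => rho * y + s : T).
    by apply: measurable_funD => //; apply: measurable_funM.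
  apply: measurable_funM => //; apply: measurable_funB; exact: measurable_funX.
have mF : measurable_fun setT (weyl_sqr l N rho s : T -> T).
  apply: measurable_sum => i; apply: measurable_sum => j.
  apply: (measurableT_comp (f := (cos : T -> T))) => //.
  exact: (continuous_measurable_fun (@continuous_cos R)).
have := @measurable_fun_ler _ T R setT (cst c) _ (measurable_cst c) mF.
have mtrue : measurable [set true] by [].
move=> /(_ measurableT [set true] mtrue).
by rewrite setTI; congr measurable; apply/seteqP; split => y /=.
Qed.

(** The exponential sums have second moment of order [N], so the bound [o(N)] holds
    almost surely along [N = k ^ 2] by Borel-Cantelli, and between squares the sums
    change too little to matter. *)
Lemma ae_weyl_sums (l : nat) (rho s b : R) : 1 <= b ->
  (forall y, al <= y <= be -> `|rho * y + s| <= b) ->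
  (exists C : R, forall n j : nat, (j < n)%N -> exists m0 : nat, forall M : nat,
    (m0 <= M)%N -> `|phase_mean r t p al (power_phase l n j rho s) M| <= C / n%:R) ->
  {ae mu, forall y : R,
    cesaro (fun n => cos (l%:R * (pi *+ 2 * (rho * y + s) ^+ n))) @ \oo --> (0 : R) /\
    cesaro (fun n => sin (l%:R * (pi *+ 2 * (rho * y + s) ^+ n))) @ \oo --> (0 : R)}.
Proof.
move=> b1 hb [C hC]; have [hp /andP[r0 r1] albe _ _ _] := ss.
have C0 : 0 <= C.
  have [m /(_ m (leqnn _))] := hC 1%N 0%N isT; rewrite divr1; exact: le_trans.
pose B (i k : nat) : set T :=
  [set y | i.+1%:R^-1 * k.+1%:R ^+ 4 <= weyl_sqr l (k.+1 ^ 2) rho s y].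
have mB i k : measurable (B i k) by apply: measurable_weyl_sqr.
have prB i k : pr (B i k) <= (1 + 2 * C) * (2 * i.+1%:R) / k.+1%:R ^+ 2.
  have kR : 0 < k.+1%:R :> R by rewrite ltr0n.
  have iR : 0 < i.+1%:R :> R by rewrite ltr0n.
  have [K K0 hK] := @weyl_sqr_lipschitz R l (k.+1 ^ 2) rho s b al be b1 hb.
  have [m0 hm0] := weyl_sqr_mean_le hp hC (k.+1 ^ 2).
  pose c : R := i.+1%:R^-1 * k.+1%:R ^+ 4.
  have c0 : 0 < c by rewrite mulr_gt0 ?invr_gt0 ?exprn_gt0.
  pose X := K * (be - al) + 1.
  have X0 : 0 < X by rewrite ltr_wpDl// mulr_ge0// subr_ge0.
  have r1' : `| `|r| | < 1 by rewrite normr_id.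
  have /cvgrPdist_le/(_ (c / 2 / X)) := cvg_expr r1'.
  move=> /(_ (divr_gt0 (divr_gt0 c0 (ltr0n _ 2)) X0))[k0 _ hk0].
  have := hk0 (k0 + m0)%N (leq_addr _ _).
  rewrite sub0r normrN ger0_norm ?exprn_ge0// ler_pdivlMr// => rk.
  have osc (w : word A (k0 + m0)) x : al <= x <= be ->
      weyl_sqr l (k.+1 ^ 2) rho s (wmap r t w x) <=
      weyl_sqr l (k.+1 ^ 2) rho s (wmap r t w al) + c / 2.
    move=> xI; have alI : al <= al <= be by rewrite lexx.
    rewrite -lerBlDl; apply: (le_trans (ler_norm _)).
    apply: (le_trans (hK _ _ (wmap_in ss w xI) (wmap_in ss w alI))).
    rewrite wmap_dist (@ger0_norm _ (x - al)); last by case/andP: xI; lra.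
    apply: le_trans rk; rewrite mulrCA ler_wpM2l ?exprn_ge0// /X.
    apply: (@le_trans _ _ (K * (be - al))); last by rewrite lerDl.
    by rewrite ler_wpM2l// lerD2r; case/andP: xI.
  have c2 : 0 < c - c / 2 by lra.
  apply: (le_trans (pr_markov ss hmu c2 (mB i k) (weyl_sqr_ge0 l _ rho s) osc)).
  have := hm0 (k0 + m0)%N (leq_addl _ _).
  set S := \sum_w _ => hS.
  apply: (@le_trans _ _ ((1 + 2 * C) * (k.+1 ^ 2)%:R / (c - c / 2))).
    by rewrite ler_wpM2r// invr_ge0 ltW.
  rewrite le_eqVlt; apply/orP; left; apply/eqP; have -> : c - c / 2 = c / 2 by field.
  rewrite /c natrX; move: kR iR; set u := k.+1%:R; set v := i.+1%:R => u0 v0.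
  by field; rewrite !gt_eqF.
have neg : mu.-negligible (\bigcup_i (lim_sup_set (B i))).
  by apply: negligible_bigcup => i; apply: (borel_cantelli_sqr (mB i) (prB i)).
apply: negligibleS neg => y /= nP; apply: contrapT => nB; apply: nP.
have ev (e : R) : 0 < e -> exists k0 : nat, forall k, (k0 <= k)%N ->
    weyl_sqr l (k ^ 2) rho s y <= e * k%:R ^+ 4.
  move=> e0; have [i _ /(_ i (leqnn i)) /= ie] := near_infty_natSinv_lt (PosNum e0).
  have : ~ lim_sup_set (B i) y by move=> h; apply: nB; exists i.
  rewrite /lim_sup_set /bigcap/= => /existsNP[n0 /not_implyP[_ nn]].
  exists n0.+1 => -[//|k] n0k; rewrite leNgt; apply/negP => h.
  apply: nn; exists k => //=; rewrite /B/=.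
  by apply: ltW; apply: le_lt_trans h; rewrite ler_wpM2r ?exprn_ge0// ltW.
split; apply: cesaro_cvg0_of_squares.
- by move=> n; exact: cos_max.
- move=> e /ev[k0 hk0]; exists k0 => k /hk0; rewrite weyl_sqrE; apply: le_trans.
  by rewrite lerDl sqr_ge0.
- by move=> n; exact: sin_max.
- move=> e /ev[k0 hk0]; exists k0 => k /hk0; rewrite weyl_sqrE; apply: le_trans.
  by rewrite lerDr sqr_ge0.
Qed.

End AlmostEverywhere.

(** * Separation of the cylinders *)

Section Geometry.
Context {R : realType}.

Lemma segment_sub_hull (X : set R) (a b x : R) : X a -> X b -> a <= x <= b -> convex_hull X x.
Proof.
move=> Xa Xb /andP[ax xb] C [Cconv XC].
have [ab|ab] := eqVneq a b; first by rewrite (_ : x = a); [exact: XC|apply: le_anti; rewrite ax andbT ab].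
have ba : 0 < b - a by rewrite subr_gt0 lt_neqAle ab (le_trans ax).
have l0 : 0 <= (b - x) / (b - a) by rewrite divr_ge0 ?subr_ge0 ?(ltW ba)// (le_trans ax).
have l1 : (b - x) / (b - a) <= 1 by rewrite ler_pdivrMr// mul1r lerB.
have := Cconv a b (Itv01 l0 l1) (mem_set (XC _ Xa)) (mem_set (XC _ Xb)).
rewrite inE; congr C.
transitivity ((b - x) / (b - a) * a + (1 - (b - x) / (b - a)) * b); first by [].
by field; rewrite gt_eqF.
Qed.

Lemma finite_positive_lower_bound (I : finType) (f : I -> R) :
  (forall i, 0 < f i) -> exists2 g, 0 < g & forall i, g <= f i.
Proof.
move=> f0; pose S := 1 + \sum_i (f i)^-1.
have S0 : 0 < S by rewrite ltr_pwDl// sumr_ge0// => i _; rewrite invr_ge0 ltW.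
exists S^-1; first by rewrite invr_gt0.
move=> i; rewrite -[leRHS]invrK lef_pV2 ?posrE ?invr_gt0//.
rewrite /S (bigD1 i)//= addrCA lerDl addr_ge0// sumr_ge0// => j _.
by rewrite invr_ge0 ltW.
Qed.

(** The images of [[al, be]] are intervals of the same length [|r| D], so two of them
    are disjoint only if their translations differ by more than [|r| D]; finitely many
    pairs leave a uniform gap. *)
Lemma separated_system_of_hull (A : finType) (r : R) (t : A -> R) (X : set R) (p : A -> R) :
  0 < `|r| < 1 -> probability_vector p ->
  self_similar_set (fun i => similarity r (t i)) X ->
  convex_strong_separation (fun i => similarity r (t i)) X ->
  exists al be g : R, [/\ X al, X be & separated_system r t p al be g].
Proof.
move=> r01 hp [X0 cX Xeq] hsep.
have cid' : {within X, continuous (idfun : R -> R)} by apply: continuous_subspaceT => x; exact: cvg_id.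
have [al /set_mem Xal al_min] := compact_EVT_min X0 cX cid'.
have [be /set_mem Xbe be_max] := compact_EVT_max X0 cX cid'.
have Xin x : X x -> al <= x <= be.
  by move=> Xx; apply/andP; split; [apply: al_min|apply: be_max]; exact: mem_set.
have albe : al <= be by have /andP[] := Xin _ Xal.
have phiX i x : X x -> X (similarity r (t i) x).
  by move=> Xx; rewrite Xeq; exists i => //; exists x.
have stab i x : al <= x <= be -> al <= similarity r (t i) x <= be.
  move=> /andP[x1 x2]; have /andP[a1 a2] := Xin _ (phiX i _ Xal).
  have /andP[b1 b2] := Xin _ (phiX i _ Xbe); rewrite /similarity in a1 a2 b1 b2 *.
  by have [r0|r0] := leP 0 r; apply/andP; split; nra.
pose D := be - al.
have sep i j : i != j -> 0 < `|t i - t j| - `|r| * D.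
  move=> ij; rewrite subr_gt0 ltNge; apply/negP => tD.
  have r0 : r != 0 by rewrite -normr_gt0; case/andP: r01.
  (* Otherwise [phi_i x = phi_j y] for some [x], [y] with [x - y = u]. *)
  pose u := (t j - t i) / r.
  have uD : `|u| <= D.
    by rewrite /u normrM normfV ler_pdivrMr ?normr_gt0// distrC mulrC.
  have ru : r * u = t j - t i by rewrite /u mulrC divfK.
  have [x [y [xI yI xy]]] : exists x y, [/\ al <= x <= be, al <= y <= be & x - y = u].
    move: uD; rewrite ler_norml /D => /andP[u1 u2].
    have [u0|u0] := leP 0 u.
      by exists (al + u), al; split; [apply/andP; split; lra|rewrite lexx|ring].
    by exists al, (al - u); split; [rewrite lexx|apply/andP; split; lra|ring].
  suff : (similarity r (t i) @` convex_hull X `&` similarity r (t j) @` convex_hull X)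
      (similarity r (t i) x) by rewrite hsep.
  split; first by exists x => //; apply: (segment_sub_hull Xal Xbe).
  exists y; first exact: (segment_sub_hull Xal Xbe).
  by rewrite /similarity; rewrite -xy in ru; lra.
pose f (ij : A * A) : R := if ij.1 == ij.2 then 1 else `|t ij.1 - t ij.2| - `|r| * D.
have [g g0 hg] : exists2 g, 0 < g & forall ij, g <= f ij.
  apply: finite_positive_lower_bound => -[i j]; rewrite /f/=.
  by case: eqVneq => // /sep.
exists al, be, g; split=> //; split=> // i j x y ij /andP[x1 x2] /andP[y1 y2].
have := hg (i, j); rewrite /f/= (negbTE ij) => /le_trans; apply.
rewrite (_ : similarity r (t i) x - similarity r (t j) y = (t i - t j) - r * (y - x)); last first.
  by rewrite /similarity; ring.
apply: le_trans (lerB_dist _ _); rewrite lerD2l lerN2 normrM ler_wpM2l//.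
by rewrite /D ler_norml; apply/andP; split; lra.
Qed.

End Geometry.

(** * Uniform distribution of the powers *)

Section AlmostEveryCylinder.
Context {R : realType} {A : finType} (r : R) (t : A -> R) (p : A -> R) (al be g : R).
Context (mu : probability (measurableTypeR R) R).
Context (ss : separated_system r t p al be g).
Context (hmu : self_similar_measure (fun i => similarity r (t i)) p mu).

Lemma ae_forall_nat (P : nat -> R -> Prop) :
  (forall n, {ae mu, forall x, P n x}) -> {ae mu, forall x, forall n, P n x}.
Proof.
move=> h; have := negligible_bigcup h.
by apply: negligibleS => x /= /existsNP[n nP]; exists n.
Qed.

Lemma ae_mono (P Q : R -> Prop) : (forall x, P x -> Q x) ->
  {ae mu, forall x, P x} -> {ae mu, forall x, Q x}.
Proof. by move=> PQ; apply: negligibleS => x /=; apply: contra_not; exact: PQ. Qed.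

Lemma ae_uniform_cylinder (rho s a b delta : R) :
  rho != 0 -> 1 < a -> 0 < delta ->
  (forall y, al <= y <= be -> a <= rho * y + s <= b) ->
  b <= a * expR delta -> - ln `|r| < 2 * entropy p ->
  16 * (- ln `|r|) * delta <= ln a * (2 * entropy p - (- ln `|r|)) ->
  {ae mu, forall y, uniformly_distributed_mod1 (fun n => (rho * y + s) ^+ n)}.
Proof.
move=> rho0 a1 delta0 hab bd h1 h2.
have b1 : 1 <= b.
  have : al <= al <= be by rewrite lexx; case: ss.
  by move=> /hab/andP[x1 x2]; lra.
have hb y : al <= y <= be -> `|rho * y + s| <= b.
  by move=> /hab/andP[x1 x2]; rewrite ger0_norm//; lra.
have := ae_forall_nat (fun l => ae_weyl_sums ss hmu b1 hb
  (power_phase_decay ss (ltn0Sn l) rho0 a1 delta0 hab bd h1 h2)).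
apply: ae_mono => y hy; by apply: weyl_criterion => -[//|l] _; exact: hy.
Qed.

(** The loss [delta] allowed in [b <= a exp delta] is proportional to [ln a], so the
    argument applies to cylinders of a fixed level only away from 1. *)
Lemma ae_uniform_above (kap : R) : 0 < kap -> - ln `|r| < 2 * entropy p ->
  {ae mu, forall x, 1 + kap <= x -> uniformly_distributed_mod1 (fun n => x ^+ n)}.
Proof.
move=> kap0 hent; have [hp /andP[r0 r1] albe st g0 _] := ss.
pose Lam := - ln `|r|; have Lam0 : 0 < Lam by rewrite oppr_gt0 ln_lt0// r0.
pose A0 := ln (1 + kap / 2); have A00 : 0 < A0 by rewrite ln_gt0//; lra.
pose delta := A0 * (2 * entropy p - Lam) / (16 * Lam).
have gam0 : 0 < 2 * entropy p - Lam by rewrite subr_gt0.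
have delta0 : 0 < delta by rewrite divr_gt0 ?mulr_gt0.
pose D := be - al; have D0 : 0 <= D by rewrite subr_ge0.
pose e := Num.min (kap / 4) (delta / 2) / (D + 1).
have D1 : 0 < D + 1 by lra.
have e0 : 0 < e by rewrite divr_gt0// lt_min; apply/andP; split; lra.
have r1' : `| `|r| | < 1 by rewrite normr_id.
have /cvgrPdist_le/(_ e e0) := cvg_expr r1'.
move=> [m _ /(_ m (leqnn m))]; rewrite sub0r normrN ger0_norm ?exprn_ge0// => rm.
pose q := `|r| ^+ m * D; have q0 : 0 <= q by rewrite mulr_ge0 ?exprn_ge0.
have qmin : q <= Num.min (kap / 4) (delta / 2).
  apply: (@le_trans _ _ (e * D)); first by rewrite ler_wpM2r.
  have mn : 0 <= Num.min (kap / 4) (delta / 2) by rewrite le_min; apply/andP; split; lra.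
  by rewrite /e mulrAC ler_pdivrMr// ler_wpM2l//; lra.
have [qk qd] : q <= kap / 4 /\ q <= delta / 2 by move: qmin; rewrite le_min => /andP[].
apply: (ae_words ss hmu (m := m)) => w.
have alI : al <= al <= be by rewrite lexx.
have near_al y : al <= y <= be -> `|wmap r t w y - wmap r t w al| <= q.
  move=> /andP[y1 y2]; rewrite wmap_dist ler_wpM2l ?exprn_ge0// ger0_norm /D; lra.
pose a := wmap r t w al - q; pose b := wmap r t w al + q.
(* If [a] is small, every point of the cylinder is below [1 + kap]. *)
have [a_big|a_small] := leP (1 + kap / 2) a; last first.
  apply: negligibleS (negligible_out_seg ss hmu) => y /= nP yI; apply: nP => hy.
  have := near_al y yI; rewrite ler_norml => /andP[_ h].
  by move: a_small; rewrite /a; lra.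
have a1 : 1 < a by lra.
have a0 : 0 < a by lra.
have hab y : al <= y <= be -> a <= r ^+ m * y + wmap r t w 0 <= b.
  move=> /near_al; rewrite wmap_affine /similarity ler_norml /a /b => /andP[h1 h2].
  by apply/andP; split; lra.
have rm0 : r ^+ m != 0 by rewrite expf_neq0// -normr_gt0.
have bd : b <= a * expR delta.
  apply: (@le_trans _ _ (a * (1 + delta))); last by rewrite ler_pM2l// expR_ge1Dx.
  have -> : b = a + 2 * q by rewrite /a /b; ring.
  have : delta <= a * delta by rewrite ler_peMl// ltW.
  by rewrite mulrDr mulr1 lerD2l; lra.
have hd : 16 * Lam * delta <= ln a * (2 * entropy p - Lam).
  rewrite (_ : 16 * Lam * delta = A0 * (2 * entropy p - Lam)); last first.
    by rewrite /delta; field; rewrite gt_eqF.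
  by rewrite ler_pM2r// ler_ln ?posrE//; lra.
apply: ae_mono (ae_uniform_cylinder rm0 a1 delta0 hab bd hent hd) => y hy _.
by rewrite wmap_affine.
Qed.

(** The points above [1 + 1 / (n + 1)] for some [n] are all the points of
    [[al, be]] but possibly 1, which is not an atom. *)
Lemma ae_uniform : 1 <= al -> - ln `|r| < 2 * entropy p ->
  {ae mu, forall x, uniformly_distributed_mod1 (fun n => x ^+ n)}.
Proof.
move=> al1 hent; have [hp /andP[r0 r1] albe _ _ _] := ss.
have ent0 : 0 < entropy p.
  have : 0 < - ln `|r| by rewrite oppr_gt0 ln_lt0// r0.
  by lra.
have above := ae_forall_nat (fun n => @ae_uniform_above (n.+1%:R^-1) ltac:(by rewrite invr_gt0) hent).
have one : mu.-negligible [set (1 : R)].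
  have m1 : measurable ([set 1] : set (measurableTypeR R)) by exact: measurable_set1.
  by apply/negligibleP => //; have := prE mu m1; rewrite (pr_point ss hmu).
have neg := negligibleU (negligibleU above (negligible_out_seg ss hmu)) one.
apply: negligibleS neg => x /= nP.
have [xI|nxI] := pselect (al <= x <= be); last by left; right.
have [x1|x1] := eqVneq x 1; first by right.
left; left => h; apply: nP.
have x1' : 0 < x - 1.
  by rewrite subr_gt0 lt_neqAle eq_sym x1 (le_trans al1)//; case/andP: xI.
have [n _ /(_ n (leqnn n)) /= hn] := near_infty_natSinv_lt (PosNum x1').
by apply: (h n); rewrite -lerBrDl; exact: ltW.
Qed.

End AlmostEveryCylinder.

Theorem theorem2p1 (R : realType) (A : finType) (r : R) (t : A -> R)
  (hr : -1 < r < 0 \/ 0 < r < 1)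
  (X : set R)
  (hX : self_similar_set (fun i => similarity r (t i)) X)
  (hsep : convex_strong_separation (fun i => similarity r (t i)) X)
  (hX1 : X `<=` [set x | 1 <= x])
  (p : A -> R) (hp : probability_vector p)
  (hdim : 1 / 2 < entropy p / (- ln `|r|))
  (mu : probability (measurableTypeR R) R)
  (hmu : self_similar_measure (fun i => similarity r (t i)) p mu) :
  {ae mu, forall x : R, uniformly_distributed_mod1 (fun n : nat => x ^+ n)}.
Proof.
have r01 : 0 < `|r| < 1.
  case: hr => /andP[r1 r2]; first by rewrite ltr0_norm//; apply/andP; split; lra.
  by rewrite gtr0_norm// r1.
have [al [be [g [Xal _ ss]]]] := separated_system_of_hull r01 hp hX hsep.
apply: (ae_uniform ss hmu (hX1 _ Xal)).
have Lam0 : 0 < - ln `|r| by rewrite oppr_gt0 ln_lt0.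
by move: hdim; rewrite ltr_pdivlMr//; lra.
Qed.
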